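(* Let $\Omega\subseteq\mathbb{R}^N$ be an open set, $s\in(0,1)$, $p\in(1,\infty)$. Let $c\in L^1_{loc}(\Omega)$ be a non-positive function and let $u\in\mathcal{W}^{s,p}(\Omega)$ be a weak super-solution of $(-\Delta_p)^s u=c(x)|u|^{p-2}u$ in $\Omega$. (1) If $\Omega$ is bounded and $u\ge 0$ a.e. in $\Omega^c$, then either $u>0$ a.e. in $\Omega$ or $u=0$ a.e. in $\mathbb{R}^N$. (2) If $u\ge0$ a.e. in $\mathbb{R}^N$, then either $u>0$ a.e. in $\Omega$ or $u=0$ a.e. in $\mathbb{R}^N$.
   Context: Notation: $A^c=\mathbb{R}^N\setminus A$; $|t|^{p-2}t:=0$ for $t=0$. For an open set $U\subseteq\mathbb{R}^N$, $W^{s,p}(U)$ is the set of $u\in L^p(U)$ with $\int_{U\times U}\frac{|u(x)-u(y)|^p}{|x-y|^{N+sp}}\,dx\,dy<\infty$, normed by the $p$-th root of $\|u\|_{L^p(U)}^p$ plus this integral. $\widetilde{W}^{s,p}(\Omega)$ is the space of all $u\in W^{s,p}(\Omega)$ whose extension by zero to $\mathbb{R}^N$ belongs to $W^{s,p}(\mathbb{R}^N)$ (elements are identified with their zero extensions); $W^{-s,p'}(\Omega)$ is its dual, with pairing $\langle\cdot,\cdot\rangle$; a function $f$ on $\Omega$ is identified with the functional $\varphi\mapsto\int_\Omega f\varphi\,dx$. $\mathcal{W}^{s,p}(\Omega)$ is the space of all $u\in L^p_{loc}(\mathbb{R}^N)$ such that for every bounded $\Omega'\subseteq\Omega$ there is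 an open set $U\supset\supset\Omega'$ with $u\in W^{s,p}(U)$, and $\int_{\mathbb{R}^N}\frac{|u(x)|^{p-1}}{(1+|x|)^{N+sp}}\,dx<\infty$. Weak super-solutions: let $f\in W^{-s,p'}(\Omega)$. If $\Omega$ is bounded, $u\in\mathcal{W}^{s,p}(\Omega)$ is a weak super-solution of $(-\Delta_p)^su=f$ in $\Omega$ if for every $\varphi\in\widetilde{W}^{s,p}(\Omega)$, $\varphi\ge0$, $$\int_{\mathbb{R}^{2N}}\frac{|u(x)-u(y)|^{p-2}(u(x)-u(y))(\varphi(x)-\varphi(y))}{|x-y|^{N+sp}}\,dx\,dy\ \ge\ \langle f,\varphi\rangle .$$ If $\Omega$ is unbounded, $u\in\mathcal{W}^{s,p}(\Omega)$ is a weak super-solution in $\Omega$ if it is a weak super-solution in every bounded open set $\Omega'\subset\Omega$. For $c\in L^1_{loc}(\Omega)$, $u\in\mathcal{W}^{s,p}(\Omega)$ is a weak super-solution of $(-\Delta_p)^su=c(x)|u|^{p-2}u$ in $\Omega$ if $f:=c|u|^{p-2}u\in W^{-s,p'}(\Omega)$ and $u$ is a weak super-solution of $(-\Delta_p)^su=f$ in $\Omega$. *)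

(* Defs.v *)
From HB Require Import structures.
From mathcomp Require Import all_boot all_order all_algebra.
From mathcomp Require Import all_classical all_reals all_analysis.
Set Implicit Arguments.
Unset Strict Implicit.
Unset Printing Implicit Defensive.
Import Order.TTheory GRing.Theory Num.Theory.
Import numFieldNormedType.Exports.

Local Open Scope classical_set_scope.
Local Open Scope ring_scope.

(* The sigma-algebra on R^N is generated by the coordinate functions, like the
   library's one on n.-tuple; it is the Borel sigma-algebra of R^N. *)
Definition measure_rV_display : measure_display.
Proof. exact: default_measure_display. Qed.

Section measurable_rV.
Context (R : realType) (N : nat).

Let coors : 'I_N -> 'rV[R]_N -> measurableTypeR R := fun i x => x ord0 i.

Let rV_set0 : g_sigma_preimage coors set0.
Proof. exact: sigma_algebra0. Qed.

Let rV_setC A : g_sigma_preimage coors A -> g_sigma_preimage coors (~` A).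
Proof. exact: sigma_algebraC. Qed.

Let rV_bigcup (F : _^nat) : (forall i, g_sigma_preimage coors (F i)) ->
  g_sigma_preimage coors (\bigcup_i (F i)).
Proof. exact: sigma_algebra_bigcup. Qed.

HB.instance Definition _ := @isMeasurable.Build measure_rV_display
  'rV[R]_N (g_sigma_preimage coors) rV_set0 rV_setC rV_bigcup.

End measurable_rV.

Section cons_rV.
Context (R : realType).

Lemma measurable_coord N (i : 'I_N) :
  measurable_fun [set: 'rV[R]_N] (fun x : 'rV[R]_N => x ord0 i : R).
Proof.
move=> _ Y mY; rewrite setTI; apply: sub_sigma_algebra => /=.
rewrite -bigcup_seq/=; exists i => /=; first by rewrite mem_index_enum.
by exists Y => //; rewrite setTI.
Qed.

Lemma measurable_fun_rV d (T : measurableType d) N (f : T -> 'rV[R]_N) :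
  (forall i, measurable_fun [set: T] (fun t => f t ord0 i : R)) ->
  measurable_fun [set: T] f.
Proof.
move=> mf _ Y mY; rewrite setTI.
suff : g_sigma_preimage (fun (i : 'I_N) (x : 'rV[R]_N) =>
    x ord0 i : measurableTypeR R) `<=` [set A | measurable (f @^-1` A)].
  exact.
apply: smallest_sub.
  split => /=.
  - by rewrite preimage_set0.
  - by move=> A mA; rewrite setTD preimage_setC; exact: measurableC.
  - by move=> F mF; rewrite preimage_bigcup; exact: bigcup_measurable.
move=> A; rewrite -bigcup_seq => -[i _ [B mB <-]] /=.
by rewrite setTI -comp_preimage -[X in measurable X]setTI; exact: mf.
Qed.

Definition cons_rV N (z : R * 'rV[R]_N) : 'rV[R]_N.+1 :=
  \row_i if unlift ord0 i is Some j then z.2 ord0 j else z.1.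

Definition uncons_rV N (x : 'rV[R]_N.+1) : R * 'rV[R]_N :=
  (x ord0 ord0, \row_j x ord0 (lift ord0 j)).

Lemma cons_rVK N : cancel (@cons_rV N) (@uncons_rV N).
Proof.
move=> [a v]; rewrite /uncons_rV /cons_rV !mxE unlift_none /=; congr (_, _).
by apply/rowP => j; rewrite !mxE liftK.
Qed.

Lemma measurable_cons_rV N : measurable_fun setT (@cons_rV N).
Proof.
apply: measurable_fun_rV => i; rewrite /cons_rV.
under eq_fun do rewrite mxE.
case: (unlift ord0 i) => [j|]; last exact: measurable_fst.
by apply: measurableT_comp (measurable_coord j) _; exact: measurable_snd.
Qed.

Lemma measurable_uncons_rV N : measurable_fun setT (@uncons_rV N).
Proof.
apply: measurable_fun_pair; first exact: measurable_coord.
apply: measurable_fun_rV => i /=.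
by under eq_fun do rewrite mxE; exact: measurable_coord.
Qed.

End cons_rV.

Section lebesgue_rV.
Local Open Scope ereal_scope.
Context (R : realType).

Section step.
Context (N : nat) (m : {sigma_finite_measure set 'rV[R]_N -> \bar R}).

Definition lebesgue_cons : set 'rV[R]_N.+1 -> \bar R :=
  pushforward (@lebesgue_measure R \x m)
    (@cons_rV R N : (measurableTypeR R * 'rV[R]_N)%type -> 'rV[R]_N.+1).

Let cons0 : lebesgue_cons set0 = 0.
Proof. by rewrite /lebesgue_cons /pushforward preimage_set0 measure0. Qed.

Let cons_ge0 A : 0 <= lebesgue_cons A.
Proof. by rewrite /lebesgue_cons /pushforward; exact: measure_ge0. Qed.

Let cons_sigma_additive : semi_sigma_additive lebesgue_cons.
Proof.
have mpre A : measurable A -> measurable (@cons_rV R N @^-1` A).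
  move=> mA; rewrite -[X in measurable X]setTI.
  exact: (@measurable_cons_rV R N).
move=> F mF tF mUF; rewrite /lebesgue_cons /pushforward preimage_bigcup.
apply: measure_semi_sigma_additive.
- by move=> n; exact: mpre.
- apply/trivIsetP => i j _ _ ij; rewrite -preimage_setI.
  by move/trivIsetP : tF => -> //; exact: preimage_set0.
- by rewrite -preimage_bigcup; exact: mpre.
Qed.

HB.instance Definition _ := isMeasure.Build _ _ _ lebesgue_cons
  cons0 cons_ge0 cons_sigma_additive.

Let cons_sigma_finite : sigma_finite setT lebesgue_cons.
Proof.
have /sigma_finiteP[F [FT ndF Foo]] := sigma_finiteT (@lebesgue_measure R).
have /sigma_finiteP[G [GT ndG Goo]] := sigma_finiteT m.
exists (fun n => @uncons_rV R N @^-1` (F n `*` G n)).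
  apply/seteqP; split=> // x _.
  have [k _ Fk] : (\bigcup_i F i) (uncons_rV x).1 by rewrite -FT.
  have [l _ Gl] : (\bigcup_i G i) (uncons_rV x).2 by rewrite -GT.
  exists (maxn k l) => //; split.
    by move: Fk; apply/subsetPset/ndF/leq_maxl.
  by move: Gl; apply/subsetPset/ndG/leq_maxr.
move=> n; have [mF Fnoo] := Foo n; have [mG Gnoo] := Goo n; split.
  rewrite -[X in measurable X]setTI.
  by apply: (@measurable_uncons_rV R N) => //; exact: measurableX.
rewrite /lebesgue_cons /pushforward -comp_preimage.
rewrite (_ : _ \o _ = id); last by apply/funext => z /=; rewrite cons_rVK.
by rewrite preimage_id product_measure1E// lte_mul_pinfty// ge0_fin_numE.
Qed.

HB.instance Definition _ :=
  Measure_isSigmaFinite.Build _ _ _ lebesgue_cons cons_sigma_finite.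

End step.

Fixpoint lebesgue_rV (N : nat) :
    {sigma_finite_measure set 'rV[R]_N -> \bar R} :=
  match N with
  | 0 => \d_ (0%R : 'rV[R]_0)
  | n.+1 => lebesgue_cons (lebesgue_rV n)
  end.

Lemma lebesgue_rV_box (N : nat) (A : 'I_N -> set (measurableTypeR R)) :
  (forall i, measurable (A i)) ->
  lebesgue_rV N [set x | forall i, A i (x ord0 i)] =
  \prod_(i < N) lebesgue_measure (A i).
Proof.
elim: N A => [A _|N IH A mA] /=.
  by rewrite big_ord0 diracE mem_set// => -[].
rewrite /lebesgue_cons /pushforward /=.
rewrite (_ : _ @^-1` _ = A ord0 `*`
    [set x : 'rV[R]_N | forall i, A (lift ord0 i) (x ord0 i)]); last first.
  apply/seteqP; split => -[a v] /=.
  - move=> Aav; split.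
      by have := Aav ord0; rewrite mxE unlift_none.
    by move=> i; have := Aav (lift ord0 i); rewrite mxE liftK.
  - by move=> [A0 AS] i; rewrite mxE; case: unliftP => [j|] ->.
rewrite product_measure1E//; last first.
  rewrite (_ : [set x | _] = \bigcap_(i in [set: 'I_N])
      ((fun x : 'rV[R]_N => x ord0 i : measurableTypeR R) @^-1` A (lift ord0 i))).
    apply: fin_bigcap_measurable => // i _; rewrite -[X in measurable X]setTI.
    exact: (measurable_coord i measurableT (mA _)).
  by apply/seteqP; split => [x h i _|x h i]; [exact: (h i)|exact: (h i I)].
by rewrite (IH (fun i => A (lift ord0 i)))// big_ord_recl.
Qed.

End lebesgue_rV.

Section fractional_sobolev.
Context (R : realType) (N : nat).
Local Notation V := 'rV[R]_N.
Local Notation mu := (lebesgue_rV R N).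
Implicit Types (s p : R) (U Omega : set V) (u phi f c : V -> R).

(* The library's norm `|x| on 'rV[R]_N is the sup norm. *)
Definition enorm (x : V) : R := Num.sqrt (\sum_(i < N) x ord0 i ^+ 2).

(* |t|^(p-2) t; it is 0 at t = 0 for every p, since powR is total. *)
Definition spow p (t : R) : R := `|t| `^ (p - 2) * t.

Definition Lp_energy p U u : \bar R := (\int[mu]_(x in U) (`|u x| `^ p)%:E)%E.

Definition in_Lp p U u : Prop :=
  measurable_fun U u /\ (Lp_energy p U u < +oo)%E.

Definition in_Lp_loc p u : Prop :=
  measurable_fun setT u /\
  forall K : set V, compact K -> (Lp_energy p K u < +oo)%E.

Definition in_L1_loc Omega c : Prop :=
  measurable_fun Omega c /\
  forall K : set V, compact K -> K `<=` Omega -> (Lp_energy 1 K c < +oo)%E.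

Definition gagliardo s p U u : \bar R :=
  (\int[mu \x mu]_(z in U `*` U)
    (`|u z.1 - u z.2| `^ p / enorm (z.1 - z.2) `^ (N%:R + s * p))%:E)%E.

Definition in_W s p U u : Prop :=
  in_Lp p U u /\ (gagliardo s p U u < +oo)%E.

Definition W_norm s p U u : \bar R :=
  ((Lp_energy p U u + gagliardo s p U u) `^ p^-1)%E.

(* An element is represented by its extension by zero to R^N. *)
Definition in_W_zero s p Omega phi : Prop :=
  [/\ in_W s p Omega phi,
      (forall x, ~ Omega x -> phi x = 0) &
      in_W s p setT phi].

(* Omega is the domain of the test space; the norm on that space is the norm
   in W^{s,p}(R^N) of the extension by zero. *)
Definition in_W_dual s p Omega (F : (V -> R) -> R) : Prop :=
  (forall (a : R) phi psi, in_W_zero s p Omega phi -> in_W_zero s p Omega psi ->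
     F (fun x => a * phi x + psi x) = a * F phi + F psi) /\
  (exists C : R, forall phi, in_W_zero s p Omega phi ->
     (`|F phi|%:E <= C%:E * W_norm s p setT phi)%E).

Definition functional_of Omega f : (V -> R) -> R :=
  fun phi => \int[mu]_(x in Omega) (f x * phi x).

Definition fun_in_W_dual s p Omega f : Prop :=
  (forall phi, in_W_zero s p Omega phi ->
     mu.-integrable Omega (fun x => (f x * phi x)%:E)) /\
  in_W_dual s p Omega (functional_of Omega f).

Definition compactly_inside (A U : set V) : Prop :=
  compact (closure A) /\ closure A `<=` U.

Definition in_calW s p Omega u : Prop :=
  [/\ in_Lp_loc p u,
      (forall Omega', bounded_set Omega' -> Omega' `<=` Omega ->
         exists U, [/\ open U, compactly_inside Omega' U & in_W s p U u]) &
      (\int[mu]_x (`|u x| `^ (p - 1) / (1 + enorm x) `^ (N%:R + s * p))%:E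
         < +oo)%E].

Definition frac_plap_form s p u phi : \bar R :=
  (\int[mu \x mu]_z
    (spow p (u z.1 - u z.2) * (phi z.1 - phi z.2)
       / enorm (z.1 - z.2) `^ (N%:R + s * p))%:E)%E.

(* The definition used when Omega is bounded. *)
Definition weak_super_bounded s p Omega (F : (V -> R) -> R) u : Prop :=
  in_calW s p Omega u /\
  forall phi, in_W_zero s p Omega phi ->
    {ae mu, forall x, 0 <= phi x} ->
    ((F phi)%:E <= frac_plap_form s p u phi)%E.

Definition weak_super s p Omega (F : (V -> R) -> R) u : Prop :=
  [/\ in_W_dual s p Omega F,
      (bounded_set Omega -> weak_super_bounded s p Omega F u) &
      (~ bounded_set Omega ->
        in_calW s p Omega u /\
        forall Omega', open Omega' -> bounded_set Omega' -> Omega' `<=` Omega ->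
          weak_super_bounded s p Omega' F u)].

(* Super-solutions of (-Delta_p)^s u = c(x) |u|^(p-2) u. *)
Definition weak_super_potential s p Omega c u : Prop :=
  let f := fun x => c x * spow p (u x) in
  [/\ in_calW s p Omega u,
      fun_in_W_dual s p Omega f &
      weak_super s p Omega (functional_of Omega f) u].

End fractional_sobolev.

(* Main.v *)
Require Import Defs.
From mathcomp Require Import all_boot all_order all_algebra.
From mathcomp Require Import all_classical all_reals all_analysis.
From mathcomp Require Import measurable_realfun.
From mathcomp Require Import ring lra.
Import Order.TTheory GRing.Theory Num.Theory.
Import numFieldNormedType.Exports.

(** Let [u] be a super-solution and [w >= 0] a Lipschitz function vanishing
off a bounded open set [S] of [Omega] outside of which [u >= 0]. Everything
comes from the one test function [phi = max 0 (w - u)].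

Since [t |-> |t|^(p-2) t] is nondecreasing, the increments [Du], [Dw], [Dphi]
of these functions between two points satisfy
[|Du|^(p-2) Du Dphi <= |Dw - Dphi|^(p-2) (Dw - Dphi) Dphi <= |Dw|^p]
(lemma [spow_truncation]), because [u = w - phi] where [phi > 0] and
[u >= w = w - phi] elsewhere. On the side of the potential, [c <= 0] and
[0 < u <= w] where the integrand is negative, so that
[<c |u|^(p-2) u, phi> >= - int |c| w^p]. Testing therefore bounds the negative
part of the integrand of the nonlocal form by
[[w]_(s,p)^p + int |c| w^p] (lemma [supersolution_energy]).

Nonnegativity, for bounded [Omega]: take [S = Omega] and [w = 0], so that the
bound is [0]. If [x] lies in [{u <= -t}] and [y] off [Omega], the integrand at
[(x, y)] is at most [- t^p |x-y|^(-N-sp)]; as the complement of [Omega] is not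
negligible, [{u <= -t}] is (lemma [supersolution_ge0]).

Strict positivity, once [u >= 0]: take [w = e eta] with [eta] a cutoff equal to
[1] on a small ball [B]. The bound is now [C e^p], while at [(x, y)] with
[x] in [B], [u x = 0] and [u y >= d >= e], the integrand is at most
[- d^(p-1) e |x-y|^(-N-sp)]. Since [p > 1], letting [e] tend to [0] gives
[int_(B /\ {u = 0}) int_{u >= d} |x-y|^(-N-sp) = 0], so one of the two sets is
negligible (lemma [supersolution_local_dichotomy]). If [{u = 0}] meets some
ball of a countable cover of [Omega] in a set of positive measure, then
[{u >= d}] is negligible for every [d > 0], that is [u = 0] a.e.; otherwise
[u > 0] a.e. in [Omega]. The form couples any two points directly, so one ball
decides for all connected components of [Omega] at once.

What remains is to see that [phi] is an admissible test function
(lemma [in_W_zero_truncation]) and that [eta] has finite energy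
(lemma [gagliardo_lipschitz_lty]). Both rest on the fact that
[y |-> min 1 (|x-y|/r)^p |x-y|^(-N-sp)] has an integral bounded uniformly in
[x] (lemma [integral_truncated_kernel]), which is obtained by summing over
dyadic annuli, so that only the measure of cubes is used. *)

Set Implicit Arguments.
Unset Strict Implicit.
Unset Printing Implicit Defensive.

Local Open Scope classical_set_scope.
Local Open Scope ring_scope.

(** * Pointwise inequalities *)

Section pointwise.
Context {R : realType}.
Implicit Types p s t a b : R.

Lemma le_powR2 p a b : 0 <= p -> 0 <= a -> a <= b -> a `^ p <= b `^ p.
Proof.
by move=> p0 a0 ab; apply: ge0_ler_powR => //; rewrite nnegrE// (le_trans a0).
Qed.

Lemma pow1R p : 1 `^ p = 1 :> R.
Proof. by rewrite powR1. Qed.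

Lemma powR_expn a p n : 0 <= a -> (a ^+ n) `^ p = (a `^ p) ^+ n.
Proof.
move=> a0; rewrite -(powR_mulrn n a0) powRAC.
exact: powR_mulrn (powR_ge0 _ _).
Qed.

Lemma powRD_le p a b : 0 <= p -> 0 <= a -> 0 <= b ->
  (a + b) `^ p <= 2 `^ p * (a `^ p + b `^ p).
Proof.
move=> p0 a0 b0; wlog ab : a b a0 b0 / a <= b.
  move=> wl; case: (leP a b) => [|/ltW] ab; first exact: wl.
  by rewrite addrC [X in _ * X]addrC; exact: wl.
apply: (@le_trans _ _ ((2 * b) `^ p)).
  by apply: le_powR2 => //; [exact: addr_ge0|rewrite mulr_natl mulr2n lerD2r].
by rewrite powRM// ler_wpM2l ?powR_ge0// lerDr powR_ge0.
Qed.

Lemma powR_dist_le p a b : 0 <= p -> 0 <= a -> 0 <= b ->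
  `|a - b| `^ p <= a `^ p + b `^ p.
Proof.
move=> p0 a0 b0; wlog ab : a b a0 b0 / a <= b.
  move=> wl; case: (leP a b) => [|/ltW] ab; first exact: wl.
  by rewrite distrC [X in _ <= X]addrC; exact: wl.
apply: (@le_trans _ _ (b `^ p)); last by rewrite lerDr powR_ge0.
by apply: le_powR2 => //; rewrite ler_distlC; apply/andP; split; lra.
Qed.

Lemma spow_ge0E p t : 1 < p -> 0 <= t -> spow p t = t `^ (p - 1).
Proof.
move=> p1 t0; rewrite /spow ger0_norm// mulrC.
have -> : p - 2 = p - 1 - 1 by lra.
by rewrite mulr_powRB1// subr_gt0.
Qed.

Lemma spowN p t : spow p (- t) = - spow p t.
Proof. by rewrite /spow normrN mulrN. Qed.

Lemma spow_ge0 p t : 0 <= t -> 0 <= spow p t.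
Proof. by move=> t0; rewrite mulr_ge0// powR_ge0. Qed.

Lemma spow_le0 p t : t <= 0 -> spow p t <= 0.
Proof. by move=> t0; rewrite /spow mulr_ge0_le0// powR_ge0. Qed.

Lemma le_spow p : 1 < p -> {homo spow p : a b / a <= b}.
Proof.
move=> p1 a b ab; case: (leP 0 a) => a0.
  rewrite !spow_ge0E//; last exact: le_trans ab.
  by apply: le_powR2 => //; rewrite subr_ge0 ltW.
case: (leP 0 b) => b0.
  by rewrite (@le_trans _ _ 0)// ?spow_ge0// spow_le0// ltW.
rewrite -(opprK a) -(opprK b) !(spowN p (- _)) lerN2 !spow_ge0E//; try lra.
by apply: le_powR2 => //; lra.
Qed.

(** When the product is positive, [b] and [a - b] have the same sign, hence both
are bounded by [a] in absolute value. *)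
Lemma spow_subM_le p a b : 1 < p -> spow p (a - b) * b <= `|a| `^ p.
Proof.
move=> p1; wlog b0 : a b / 0 <= b.
  move=> wl; case: (leP 0 b) => [|/ltW] b0; first exact: wl.
  rewrite -(normrN a) -mulrNN -spowN.
  have -> : - (a - b) = - a - (- b) by ring.
  by apply: wl; rewrite oppr_ge0.
case: (leP a b) => ab.
  rewrite (@le_trans _ _ 0)// ?powR_ge0// mulr_le0_ge0//.
  by apply: spow_le0; rewrite subr_le0.
have a0 : 0 <= a by rewrite (le_trans b0)// ltW.
rewrite ger0_norm// -mulr_powRB1//; last lra.
rewrite mulrC spow_ge0E//; last by rewrite subr_ge0 ltW.
apply: ler_pM => //; rewrite ?powR_ge0//; first exact: ltW.
by apply: le_powR2; lra.
Qed.

(** The inequality behind the whole argument. Where [f = max 0 (A - a)] is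
positive it equals [A - a], and it is at least [A - a] anyway; so if [f > g],
replacing [a - b] by [(A - B) - (f - g)] increases it, and symmetrically. *)
Lemma spow_truncation p a b A B : 1 < p ->
  spow p (a - b) * (Num.max 0 (A - a) - Num.max 0 (B - b)) <=
  `|A - B| `^ p.
Proof.
move=> p1; set f := Num.max 0 (A - a); set g := Num.max 0 (B - b).
have f0 : 0 <= f by rewrite le_max lexx.
have g0 : 0 <= g by rewrite le_max lexx.
have fA : A - a <= f by rewrite le_max lexx orbT.
have gB : B - b <= g by rewrite le_max lexx orbT.
have fE : 0 < f -> f = A - a.
  by rewrite /f; case: (leP 0 (A - a)) => //; rewrite ltxx.
have gE : 0 < g -> g = B - b.
  by rewrite /g; case: (leP 0 (B - b)) => //; rewrite ltxx.
apply: (le_trans _ (spow_subM_le (A - B) (f - g) p1)).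
case: (ltgtP f g) => fg.
- rewrite ler_wnM2r//; first lra.
  apply: le_spow => //; have := gE (le_lt_trans f0 fg); lra.
- rewrite ler_wpM2r//; first lra.
  apply: le_spow => //; have := fE (le_lt_trans g0 fg); lra.
- by rewrite fg subrr !mulr0.
Qed.

End pointwise.

(** * Topology and Lebesgue measure of R^N *)

Section euclidean_space.
Context {R : realType} {N : nat}.
Local Notation V := 'rV[R]_N.
Local Notation mu := (lebesgue_rV R N).
Local Notation ratV q := (map_mx (ratr : rat -> R) q : V).

(** The norm of row vectors is the sup norm, so that balls are cubes. *)
Lemma normr_rV_ltP (x : V) (r : R) : 0 < r ->
  `|x| < r <-> forall i, `|x ord0 i| < r.
Proof.
move=> r0; rewrite [in X in X <-> _]/Num.Def.normr/= mx_normrE; split.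
  by move=> /bigmax_ltP[_ h] i; exact: (h (ord0, i)).
by move=> h; apply/bigmax_ltP; split => // -[i j] _ /=; rewrite (ord1 i).
Qed.

Lemma ball_rVE (q : V) (r : R) : 0 < r ->
  ball q r = [set x | forall i, `](q ord0 i - r), (q ord0 i + r)[%classic (x ord0 i)].
Proof.
move=> r0; apply/seteqP; split => x /=; rewrite -ball_normE /=.
  move=> /normr_rV_ltP -/(_ r0) h i; have := h i.
  by rewrite !mxE distrC in_itv/= ltr_distl.
move=> h; apply/normr_rV_ltP => // i; have := h i.
by rewrite in_itv/= !mxE distrC ltr_distl.
Qed.

Lemma measurable_ball_rV (q : V) (r : R) : measurable (ball q r).
Proof.
case: (leP r 0) => r0; first by rewrite le0_ball0.
have -> : ball q r = \bigcap_(i in [set: 'I_N])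
    ((fun x : V => x ord0 i : measurableTypeR R) @^-1`
      `](q ord0 i - r), (q ord0 i + r)[%classic).
  rewrite ball_rVE//.
  by apply/seteqP; split => [x h i _|x h i]; [exact: h|exact: (h i I)].
apply: fin_bigcap_measurable => // i _; rewrite -[X in measurable X]setTI.
exact: (measurable_coord i measurableT).
Qed.

Lemma lebesgue_rV_ball (q : V) (r : R) : 0 < r ->
  mu (ball q r) = ((2 * r) ^+ N)%:E.
Proof.
move=> r0; rewrite ball_rVE//.
rewrite (@lebesgue_rV_box R N
  (fun i => `](q ord0 i - r), (q ord0 i + r)[%classic))//.
rewrite (eq_bigr (fun=> (2 * r)%:E)); last first.
  move=> i _; rewrite lebesgue_measure_itv/= lte_fin.
  rewrite ifT; last by lra.
  by rewrite -EFinB; congr EFin; ring.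
by rewrite prodEFin prodr_const card_ord.
Qed.

Lemma bounded_set_sub_ball (A : set V) : bounded_set A ->
  exists2 r, 0 < r & A `<=` ball 0 r.
Proof.
move=> [M [_ hM]]; exists (`|M| + 2); first by rewrite ltr_wpDl.
move=> x Ax; rewrite -ball_normE/= sub0r normrN.
apply: (@le_lt_trans _ _ (`|M| + 1)); last by lra.
by apply: (hM (`|M| + 1)) => //; rewrite (le_lt_trans (ler_norm M))// ltrDl.
Qed.

Lemma lebesgue_rV_bounded (A : set V) : measurable A -> bounded_set A ->
  (mu A < +oo)%E.
Proof.
move=> mA /bounded_set_sub_ball[r r0 Ar].
apply: (@le_lt_trans _ _ (mu (ball 0 r))); last first.
  by rewrite lebesgue_rV_ball// ltry.
by apply: le_measure => //; rewrite inE//; exact: measurable_ball_rV.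
Qed.

Lemma dense_rat_rV (x : V) (r : R) : 0 < r ->
  exists q : 'rV[rat]_N, ball (ratV q) r x.
Proof.
move=> r0.
have h i : exists q : rat, (x ord0 i - r < ratr q < x ord0 i + r)%R.
  have /rat_in_itvoo[q] : x ord0 i - r < x ord0 i + r by lra.
  by rewrite in_itv/= => qr; exists q.
have [f hf] := choice h.
exists (\row_i f i); rewrite -ball_normE/=; apply/normr_rV_ltP => // i.
by rewrite !mxE ltr_distl.
Qed.

(** The factor [3] leaves room, inside [A], for a cutoff supported in the
closure of the ball of twice the radius. *)
Lemma open_rV_ball_cover (A : set V) : open A ->
  A = \bigcup_(i in [set i : 'rV[rat]_N * nat |
        ball (ratV i.1) (3 * i.2.+1%:R^-1) `<=` A])
      ball (ratV i.1) i.2.+1%:R^-1.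
Proof.
move=> oA; apply/seteqP; split => x; last first.
  move=> [[q n] /= qA xq]; apply: qA; apply: le_ball xq.
  by rewrite ler_peMl ?invr_ge0// ler1n.
move=> Ax; have /nbhs_ballP[e/= e0 eA] : nbhs x A by exact: open_nbhs_nbhs.
(* [q] will be within [1/(n+1)] of [x], hence the ball of radius [3/(n+1)]
   about [q] within [4/(n+1)] of [x]. *)
have [n _ hn] : exists2 n, True & 4 * n.+1%:R^-1 < e.
  have e4 : 0 < e / 4 by rewrite divr_gt0.
  have [n _ /(_ n (leqnn n))/= hn] := near_infty_natSinv_lt (PosNum e4).
  by exists n => //; move: hn; rewrite ltr_pdivlMr// mulrC.
have n0 : 0 < n.+1%:R^-1 :> R by rewrite invr_gt0.
have [q qx] := dense_rat_rV x n0.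
exists (q, n) => //= y qy; apply: eA.
move: qx qy; rewrite -!ball_normE /= => qx qy.
rewrite (le_lt_trans (ler_distD (ratV q) _ _))// distrC.
rewrite (lt_trans (ltrD qx qy))// (le_lt_trans _ hn)//.
by rewrite -[X in X + _]mul1r -mulrDl lexx.
Qed.

Lemma open_measurable_rV (A : set V) : open A -> measurable A.
Proof.
move=> /open_rV_ball_cover ->; rewrite bigcup_mkcond.
apply: countable_bigcupT_measurable => // -[q n].
by case: ifPn => // _; exact: measurable_ball_rV.
Qed.

Lemma closed_measurable_rV (A : set V) : closed A -> measurable A.
Proof.
move=> cA; rewrite -(setCK A); apply: measurableC.
by apply: open_measurable_rV; exact: closed_openC.
Qed.

Lemma continuous_measurable_rV (f : V -> R) : continuous f ->
  measurable_fun setT f.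
Proof.
move=> cf _; apply: (measurability _ (RGenOInfty.measurableE R)) => //.
move=> /= _ [_ [a ->] <-]; rewrite setTI; apply: open_measurable_rV.
by apply: open_comp => //; move=> x _; exact: cf.
Qed.

Lemma measurable_enorm : measurable_fun setT (@enorm R N).
Proof.
apply: (@measurableT_comp _ _ _ _ _ _ (@Num.sqrt R)).
  apply: continuous_measurable_fun; exact: sqrt_continuous.
apply: measurable_sum => i.
by apply: measurable_funX; exact: measurable_coord.
Qed.

Lemma measurable_rV_sub : measurable_fun setT (fun z : V * V => z.1 - z.2).
Proof.
apply: measurable_fun_rV => i; under eq_fun do rewrite !mxE.
by apply: measurable_funB; apply: (measurableT_comp (measurable_coord i)).
Qed.

Lemma enorm_ge0 (x : V) : 0 <= enorm x.
Proof. exact: sqrtr_ge0. Qed.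

Lemma enormN (x : V) : enorm (- x) = enorm x.
Proof. by rewrite /enorm; under eq_bigr do rewrite mxE sqrrN. Qed.

Lemma enorm_distC (x y : V) : enorm (x - y) = enorm (y - x).
Proof. by rewrite -enormN opprB. Qed.

Lemma coord_le_enorm (x : V) i : `|x ord0 i| <= enorm x.
Proof.
rewrite -sqrtr_sqr /enorm ler_wsqrtr// (bigD1 i)//= lerDl.
by apply: sumr_ge0 => j _; exact: sqr_ge0.
Qed.

(** The topology is that of the sup norm and the kernel involves the Euclidean
one; this comparison lets estimates pass from one to the other. *)
Lemma norm_le_enorm (x : V) : `|x| <= enorm x.
Proof.
rewrite [leLHS]/Num.Def.normr/= mx_normrE; apply/bigmax_leP.
split; first exact: enorm_ge0.
by move=> -[i j] _ /=; rewrite (ord1 i); exact: coord_le_enorm.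
Qed.

Lemma enorm_gt0 (x : V) : x != 0 -> 0 < enorm x.
Proof.
by move=> x0; rewrite (lt_le_trans _ (norm_le_enorm x))// normr_gt0.
Qed.

End euclidean_space.

(** * The truncated singular kernel *)

Section kernel.
Context {R : realType} {N : nat}.
Local Notation V := 'rV[R]_N.
Local Notation mu := (lebesgue_rV R N).

Lemma measurable_dist_powR (a : R) :
  measurable_fun setT (fun z : V * V => enorm (z.1 - z.2) `^ a).
Proof.
apply: (measurableT_comp (measurable_powR a)).
exact: (measurableT_comp measurable_enorm measurable_rV_sub).
Qed.

Lemma measurable_div_dist_powR (a : R) (f : V * V -> R) :
  measurable_fun setT f ->
  measurable_fun setT (fun z : V * V => f z / enorm (z.1 - z.2) `^ a).
Proof.
move=> mf; under eq_fun do rewrite -powRN.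
by apply: measurable_funM => //; exact: measurable_dist_powR.
Qed.

Lemma pow2_bracket (t : R) : 1 <= t -> exists n, 2 ^+ n <= t < 2 ^+ n.+1.
Proof.
move=> t1.
have ex : exists n, t < 2 ^+ n by exists (Num.bound t); exact: upper_nthrootP.
case: (ex_minnP ex) => -[|n] tn nmin.
  by move: tn; rewrite expr0 ltNge t1.
exists n; rewrite tn andbT leNgt; apply/negP => /nmin.
by rewrite ltnn.
Qed.

Lemma sum_geometric_le (q : R) n : 0 <= q -> q < 1 ->
  \sum_(0 <= i < n) q ^+ i <= (1 - q)^-1.
Proof.
move=> q0 q1; have q10 : 0 < 1 - q by rewrite subr_gt0.
rewrite -[leRHS]mul1r ler_pdivlMr// big_mkord -opprB mulrN mulrC -subrX1.
by rewrite opprB gerBl exprn_ge0.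
Qed.

(** The integrand is dominated by the series of the indicators of the balls
weighted by the [a n], which is integrated termwise. *)
Lemma integral_le_geometric_cover (D : set V) (g : V -> R) (x : V)
    (a rho : nat -> R) (C q : R) :
  measurable D -> measurable_fun D g -> (forall y, D y -> 0 <= g y) ->
  (forall n, 0 <= a n) -> (forall n, 0 < rho n) ->
  (forall y, D y -> g y != 0 -> exists n, ball x (rho n) y /\ g y <= a n) ->
  0 <= q -> q < 1 -> (forall n, a n * (2 * rho n) ^+ N <= C * q ^+ n) ->
  (\int[mu]_(y in D) (g y)%:E <= (C / (1 - q))%:E)%E.
Proof.
move=> mD mg g0 a0 rho0 gcov q0 q1 aq.
have C0 : 0 <= C.
  have := aq 0; rewrite expr0 mulr1; apply: le_trans.
  by rewrite mulr_ge0// exprn_ge0// mulr_ge0// ltW.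
pose f n (y : V) : \bar R := ((a n)%:E * (\1_(ball x (rho n)) y)%:E)%E.
have f0 n y : (0 <= f n y)%E by apply: mule_ge0; rewrite lee_fin.
have mf n : measurable_fun D (f n).
  apply: emeasurable_funM => //; apply/measurable_EFinP.
  by apply: measurable_indic; exact: measurable_ball_rV.
apply: (@le_trans _ _ (\int[mu]_(y in D) \big[+%E/0%R]_(0 <= n <oo) f n y)%E).
  apply: ge0_le_integral => //.
  - exact/measurable_EFinP.
  - by apply: ge0_emeasurable_sum => // n y _ _; exact: f0.
  - move=> y Dy; have [->|gy] := eqVneq (g y) 0.
      by apply: nneseries_ge0 => n _ _; exact: f0.
    have [n [xy gn]] := gcov _ Dy gy.
    apply: (@le_trans _ _ (f n y)).
      by rewrite /f indicE mem_set// mule1 lee_fin.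
    rewrite (nneseriesD1 (n := n))//.
    by apply: leeDl; apply: nneseries_ge0 => k _ _; exact: f0.
rewrite integral_nneseries//.
have If n : (\int[mu]_(y in D) f n y <= (C * q ^+ n)%:E)%E.
  rewrite ge0_integralZl//; last 2 first.
  - apply/measurable_EFinP; apply: measurable_indic; exact: measurable_ball_rV.
  - by rewrite lee_fin.
  rewrite integral_indic//; last exact: measurable_ball_rV.
  apply: (@le_trans _ _ ((a n)%:E * mu (ball x (rho n)))%E).
    apply: lee_wpmul2l; first by rewrite lee_fin.
    apply: le_measure; rewrite ?inE//.
    - by apply: measurableI => //; exact: measurable_ball_rV.
    - exact: measurable_ball_rV.
  by rewrite lebesgue_rV_ball// -EFinM lee_fin.
apply: lime_le.
  by apply: is_cvg_nneseries => n _ _; exact: integral_ge0.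
apply: nearW => n.
apply: (@le_trans _ _ (\sum_(0 <= i < n) (C * q ^+ i)%:E)%E).
  by apply: lee_sum => i _; exact: If.
by rewrite sumEFin lee_fin -mulr_sumr ler_wpM2l// sum_geometric_le.
Qed.

(** One kernel for two purposes: at distance at least [r] it is the singular kernel
itself, and below [r] the extra factor is what a Lipschitz function gains. *)
Definition truncated_kernel (s p r : R) (z : V * V) : R :=
  Num.min 1 (enorm (z.1 - z.2) / r) `^ p / enorm (z.1 - z.2) `^ (N%:R + s * p).

Lemma truncated_kernel_ge0 s p r z : 0 <= truncated_kernel s p r z.
Proof. by rewrite divr_ge0// powR_ge0. Qed.

Lemma truncated_kernelC s p r x y :
  truncated_kernel s p r (x, y) = truncated_kernel s p r (y, x).
Proof. by rewrite /truncated_kernel/= enorm_distC. Qed.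

Lemma measurable_truncated_kernel s p r :
  measurable_fun setT (truncated_kernel s p r).
Proof.
apply: measurable_div_dist_powR; apply: (measurableT_comp (measurable_powR p)).
apply: measurable_minr => //; apply: measurable_funM => //.
exact: (measurableT_comp measurable_enorm measurable_rV_sub).
Qed.

(** The annulus of scale [t = r b^n] is contained in the ball of radius [2 t] and in
the points at distance at least [t / 2], hence the factors [2]. Up to constants
and the weight [m], its mass is [t^N t^(-N-sp) = t^(-sp)]. *)
Lemma dyadic_mass (s p r b m : R) n : 0 < r -> 0 < b ->
  2 `^ (N%:R + s * p) * m * (r * b ^+ n) `^ (- (N%:R + s * p)) *
    (2 * (2 * (r * b ^+ n))) ^+ N =
  2 `^ (N%:R + s * p) * 4 ^+ N * r `^ (- (s * p)) * (m * (b `^ (- (s * p))) ^+ n).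
Proof.
move=> r0 b0; set t := r * b ^+ n.
have t0 : 0 < t by rewrite mulr_gt0// exprn_gt0.
have -> : 2 * (2 * t) = 4 * t by ring.
have tE : t `^ (- (N%:R + s * p)) * t ^+ N = t `^ (- (s * p)).
  rewrite -powR_mulrn; last exact: ltW.
  rewrite -powRD; last by rewrite (gt_eqF t0) implybT.
  by congr (_ `^ _); ring.
rewrite -(powR_expn _ _ (ltW b0)).
rewrite exprMn.
transitivity (2 `^ (N%:R + s * p) * 4 ^+ N * m *
   (t `^ (- (N%:R + s * p)) * t ^+ N)); first by ring.
by rewrite tE powRM ?exprn_ge0// 1?ltW//; ring.
Qed.

Lemma truncated_kernel_le (s p r m rho : R) (x y : V) :
  0 <= N%:R + s * p -> 0 < rho -> rho / 2 <= enorm (x - y) ->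
  Num.min 1 (enorm (x - y) / r) `^ p <= m ->
  truncated_kernel s p r (x, y) <=
    2 `^ (N%:R + s * p) * m * rho `^ (- (N%:R + s * p)).
Proof.
move=> al0 rho0 rhoxy hm; rewrite /truncated_kernel/=.
set al := N%:R + s * p in al0 *.
rewrite [X in _ <= X * _]mulrC -mulrA.
have rho20 : 0 < rho / 2 by rewrite divr_gt0.
have -> : 2 `^ al * rho `^ (- al) = ((rho / 2) `^ al)^-1.
  rewrite -[in RHS]powRN powRM ?invr_ge0// 1?ltW// mulrC.
  by rewrite -[in RHS](powR_inv1 (a := 2))// -powRrM mulN1r opprK.
apply: ler_pM; rewrite ?powR_ge0 ?invr_ge0 ?powR_ge0//.
by rewrite lef_pV2 ?posrE ?powR_gt0 ?le_powR2 ?(lt_le_trans rho20)// ltW.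
Qed.

(** The annuli at distance about [r 2^n] contribute [(2^(-sp))^n], and those at
distance about [r 2^(-n)] contribute [(2^(-(p-sp)))^n]. *)
Lemma integral_truncated_kernel (s p r : R) :
  0 < s -> s < 1 -> 0 < p -> 0 < r ->
  exists C : R, forall x : V,
    (\int[mu]_y (truncated_kernel s p r (x, y))%:E <= C%:E)%E.
Proof.
move=> s0 s1 p0 r0; pose al := N%:R + s * p.
have al0 : 0 < al by rewrite ltr_wpDl// mulr_gt0.
pose C := 2 `^ al * 4 ^+ N * r `^ (- (s * p)).
pose q1 : R := 2 `^ (- (s * p)); pose q2 : R := 2^-1 `^ (p - s * p).
have sp0 : 0 < s * p by rewrite mulr_gt0.
have psp0 : 0 < p - s * p by rewrite -[X in X - _]mul1r -mulrBl mulr_gt0// subr_gt0.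
exists (C / (1 - q1) + C / (1 - q2)) => x.
(* Powers of [2] bracket [|x-y|/r] on [A], and [r/|x-y|] off [A]. *)
pose A : set V := [set y | r <= enorm (x - y)].
have mpx : measurable_fun setT (fun y : V => (x, y)).
  exact: measurable_fun_pair.
have mk : measurable_fun setT (fun y : V => truncated_kernel s p r (x, y)).
  exact: measurableT_comp (@measurable_truncated_kernel s p r) mpx.
have menx : measurable_fun setT (fun y : V => enorm (x - y)).
  have := measurableT_comp (@measurable_rV_sub R N) mpx.
  exact: measurableT_comp (@measurable_enorm R N).
have mA : measurable A.
  have -> : A = (fun y : V => enorm (x - y)) @^-1` `[r, +oo[%classic.
    by apply/seteqP; split => y /=; rewrite in_itv/= andbT.
  by rewrite -[X in measurable X]setTI; exact: menx.
have mCA : measurable (~` A) by exact: measurableC.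
rewrite -(setUv A) ge0_integral_setU//; last 3 first.
- by rewrite setUv; exact/measurable_EFinP.
- by move=> y _; rewrite lee_fin truncated_kernel_ge0.
- by rewrite disj_set2E setICr.
rewrite EFinD; apply: leeD.
- apply: (@integral_le_geometric_cover A _ x
    (fun n => 2 `^ al * 1 * (r * 2 ^+ n) `^ (- al))
    (fun n => 2 * (r * 2 ^+ n)) C q1) => //.
  + exact: measurable_funTS.
  + by move=> y _; exact: truncated_kernel_ge0.
  + by move=> n; rewrite !mulr_ge0 ?powR_ge0.
  + by move=> n; rewrite !mulr_gt0 ?exprn_gt0.
  + move=> y Ay _; have /pow2_bracket[n /andP[n1 n2]] : 1 <= enorm (x - y) / r.
      by rewrite ler_pdivlMr// mul1r.
    rewrite ler_pdivlMr// mulrC in n1; rewrite ltr_pdivrMr// in n2.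
    have rn0 : 0 < r * 2 ^+ n by rewrite mulr_gt0// exprn_gt0.
    exists n; split.
      rewrite -ball_normE/= (le_lt_trans (norm_le_enorm _))// (lt_le_trans n2)//.
      by rewrite exprS mulrC mulrCA.
    apply: truncated_kernel_le => //; first exact: ltW.
      by rewrite (le_trans _ n1)//; lra.
    rewrite -[leRHS](pow1R p) le_powR2 ?ge_min ?lexx//; first exact: ltW.
    by rewrite le_min ler01 divr_ge0 ?enorm_ge0// ltW.
  + exact: powR_ge0.
  + rewrite /q1 powRN invf_lt1 ?powR_gt0// -[ltLHS](pow1R (s * p)).
    by rewrite gt0_ltr_powR ?nnegrE// ltr1n.
  + by move=> n; rewrite dyadic_mass// mul1r.
- apply: (@integral_le_geometric_cover (~` A) _ x
    (fun n => 2 `^ al * (2^-1 ^+ n) `^ p * (r * 2^-1 ^+ n) `^ (- al))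
    (fun n => 2 * (r * 2^-1 ^+ n)) C q2) => //.
  + exact: measurable_funTS.
  + by move=> y _; exact: truncated_kernel_ge0.
  + by move=> n; rewrite !mulr_ge0 ?powR_ge0.
  + by move=> n; rewrite !mulr_gt0 ?exprn_gt0.
  + move=> y /negP; rewrite -ltNge => yr k0.
    have t0 : 0 < enorm (x - y).
      rewrite lt_neqAle enorm_ge0 andbT; apply: contra_neq k0.
      rewrite /truncated_kernel/= => <-; rewrite mul0r.
      by rewrite (min_idPr _)// powR0 ?mul0r// gt_eqF.
    have /pow2_bracket[n /andP[n1 n2]] : 1 <= r / enorm (x - y).
      by rewrite ler_pdivlMr// mul1r ltW.
    rewrite ler_pdivlMr// mulrC in n1; rewrite ltr_pdivrMr// in n2.
    have rn0 : 0 < r * 2^-1 ^+ n by rewrite mulr_gt0// exprn_gt0.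
    have tn : enorm (x - y) <= r * 2^-1 ^+ n.
      by rewrite exprVn ler_pdivlMr// exprn_gt0.
    exists n; split.
      rewrite -ball_normE/= (le_lt_trans (norm_le_enorm _))//.
      by rewrite (le_lt_trans tn)// ltr_pMl// ltr1n.
    apply: truncated_kernel_le => //; first exact: ltW.
      rewrite exprVn ler_pdivrMr// ler_pdivrMr ?exprn_gt0//.
      by rewrite -mulrA -exprS mulrC ltW.
    apply: le_powR2; first exact: ltW.
      by rewrite le_min ler01 divr_ge0 ?enorm_ge0// ltW.
    by rewrite ge_min ler_pdivrMr// mulrC tn orbT.
  + exact: powR_ge0.
  + rewrite /q2 -[ltRHS](pow1R (p - s * p)).
    by rewrite gt0_ltr_powR ?nnegrE// invf_lt1// ltr1n.
  + move=> n; rewrite dyadic_mass// le_eqVlt; apply/orP; left; apply/eqP.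
    congr (_ * _); rewrite /q2 powRD; last by rewrite invr_eq0 pnatr_eq0 implybT.
    by rewrite exprMn powR_expn.
Qed.

End kernel.

(** * Double integrals *)

Section product_estimates.
Context {R : realType} {N : nat}.
Local Notation V := 'rV[R]_N.
Local Notation mu := (lebesgue_rV R N).

Lemma integral_EFin_indic d (T : measurableType d)
    (m : {measure set T -> \bar R}) (D : set T) (f : T -> R) :
  (\int[m]_(x in D) (f x)%:E = \int[m]_x (\1_D x * f x)%:E)%E.
Proof.
rewrite integral_mkcond; apply: eq_integral => x _.
by rewrite patchE indicE; case: ifPn; rewrite ?mul1r ?mul0r.
Qed.

Lemma ae_fst (P : V -> Prop) : {ae mu, forall x, P x} ->
  {ae (mu \x mu)%E, forall z, P z.1}.
Proof.
move=> [A [mA A0 PA]]; exists (A `*` setT); split.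
- exact: measurableX.
- transitivity (mu A * mu setT)%E; first exact: product_measure1E.
  by rewrite (_ : mu A = 0%E) ?mul0e.
- by move=> z /= /PA Az; split.
Qed.

Lemma ae_snd (P : V -> Prop) : {ae mu, forall x, P x} ->
  {ae (mu \x mu)%E, forall z, P z.2}.
Proof.
move=> [A [mA A0 PA]]; exists (setT `*` A); split.
- exact: measurableX.
- transitivity (mu setT * mu A)%E; first exact: product_measure1E.
  by rewrite (_ : mu A = 0%E) ?mule0.
- by move=> z /= /PA Az; split.
Qed.

Lemma measurable_comp_fst (f : V -> R) : measurable_fun setT f ->
  measurable_fun setT (fun z : V * V => f z.1).
Proof. by move=> mf; exact: measurableT_comp mf measurable_fst. Qed.

Lemma measurable_comp_snd (f : V -> R) : measurable_fun setT f ->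
  measurable_fun setT (fun z : V * V => f z.2).
Proof. by move=> mf; exact: measurableT_comp mf measurable_snd. Qed.

Lemma measurable_diff (f : V -> R) : measurable_fun setT f ->
  measurable_fun setT (fun z : V * V => f z.1 - f z.2).
Proof.
move=> mf; apply: measurable_funB.
  exact: measurable_comp_fst.
exact: measurable_comp_snd.
Qed.

Lemma measurable_norm_powR d (T : measurableType d) (q : R) (f : T -> R) :
  measurable_fun setT f -> measurable_fun setT (fun z => `|f z| `^ q).
Proof.
move=> mf; apply: (measurableT_comp (measurable_powR q)).
exact: measurableT_comp mf.
Qed.

(** Each of the two terms is integrated first in the variable that is absent from
[a], whence the two orders in Tonelli's theorem. *)
Lemma integral_truncated_kernel_lty (s p r : R) (a : V -> R) :
  0 < s -> s < 1 -> 0 < p -> 0 < r ->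
  measurable_fun setT a -> (forall x, 0 <= a x) ->
  (\int[mu]_x (a x)%:E < +oo)%E ->
  (\int[mu \x mu]_z ((a z.1 + a z.2) * truncated_kernel s p r z)%:E < +oo)%E.
Proof.
move=> s0 s1 p0 r0 ma a0 aoo.
have [C hC] := integral_truncated_kernel (N := N) s0 s1 p0 r0.
have mk := @measurable_truncated_kernel R N s p r.
have m1 : measurable_fun setT
    (fun z : V * V => (a z.1 * truncated_kernel s p r z)%:E).
  by apply/measurable_EFinP/measurable_funM => //; exact: measurable_comp_fst.
have m2 : measurable_fun setT
    (fun z : V * V => (a z.2 * truncated_kernel s p r z)%:E).
  by apply/measurable_EFinP/measurable_funM => //; exact: measurable_comp_snd.
have k0 := @truncated_kernel_ge0 R N s p r.
have mky x : measurable_fun setT (fun y : V => (truncated_kernel s p r (x, y))%:E).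
  apply/measurable_EFinP; apply: (measurableT_comp mk).
  exact: measurable_fun_pair.
have C0 : 0 <= C.
  by rewrite -lee_fin (le_trans _ (hC 0))// integral_ge0// => y _; rewrite lee_fin.
have bound : (\int[mu]_x ((a x)%:E * \int[mu]_y (truncated_kernel s p r (x, y))%:E)
    < +oo)%E.
  apply: (@le_lt_trans _ _ (\int[mu]_x (C%:E * (a x)%:E))%E); last first.
    rewrite ge0_integralZl//.
    - by rewrite lte_mul_pinfty// ?lee_fin.
    - exact/measurable_EFinP.
    - by move=> x _; rewrite lee_fin.
  apply: ge0_le_integral => //.
  - by move=> x _; rewrite mule_ge0 ?lee_fin// integral_ge0// => y _; rewrite lee_fin.
  - apply: emeasurable_funM; first exact/measurable_EFinP.
    apply: (measurable_fun_fubini_tonelli_F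
      (fun z : V * V => (truncated_kernel s p r z)%:E)).
      exact/measurable_EFinP.
    by move=> z; rewrite lee_fin.
  - by apply: emeasurable_funM => //; exact/measurable_EFinP.
  - by move=> x _; rewrite muleC lee_wpmul2r ?lee_fin.
under eq_integral do rewrite mulrDl EFinD.
rewrite ge0_integralD//; last 2 first.
- by move=> z _; rewrite lee_fin mulr_ge0.
- by move=> z _; rewrite lee_fin mulr_ge0.
apply: lte_add_pinfty.
- rewrite fubini_tonelli1//; last by move=> z; rewrite lee_fin mulr_ge0.
  apply: le_lt_trans bound; rewrite le_eqVlt; apply/orP; left; apply/eqP.
  apply: eq_integral => x _; rewrite /fubini_F/=.
  under eq_integral do rewrite EFinM.
  by rewrite ge0_integralZl ?lee_fin// => y _; rewrite lee_fin.
- rewrite fubini_tonelli2//; last by move=> z; rewrite lee_fin mulr_ge0.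
  apply: le_lt_trans bound; rewrite le_eqVlt; apply/orP; left; apply/eqP.
  apply: eq_integral => x _; rewrite /fubini_G/=.
  under eq_integral do rewrite EFinM truncated_kernelC.
  by rewrite ge0_integralZl ?lee_fin// => y _; rewrite lee_fin.
Qed.

Lemma measurable_gagliardo (s p : R) (f : V -> R) : measurable_fun setT f ->
  measurable_fun setT (fun z : V * V =>
    `|f z.1 - f z.2| `^ p / enorm (z.1 - z.2) `^ (N%:R + s * p)).
Proof.
move=> mf; apply: measurable_div_dist_powR; apply: measurable_norm_powR.
exact: measurable_diff.
Qed.

Lemma gagliardo_setT (s p : R) (f : V -> R) :
  gagliardo s p setT f = (\int[mu \x mu]_z
    (`|f z.1 - f z.2| `^ p / enorm (z.1 - z.2) `^ (N%:R + s * p))%:E)%E.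
Proof. by rewrite /gagliardo setXTT. Qed.

Lemma in_W_sub (s p : R) (U U' : set V) (f : V -> R) :
  measurable U -> measurable U' -> U `<=` U' ->
  measurable_fun setT f -> in_W s p U' f -> in_W s p U f.
Proof.
move=> mU mU' UU' mf [[_ fp] fg]; split; first split.
- exact: measurable_funTS.
- apply: le_lt_trans fp; apply: ge0_subset_integral => //.
  apply/measurable_EFinP; apply: measurable_funTS.
  exact: measurable_norm_powR.
- apply: le_lt_trans fg; apply: ge0_subset_integral => //.
  + exact: measurableX.
  + exact: measurableX.
  + by apply/measurable_EFinP; apply: measurable_funTS; exact: measurable_gagliardo.
  + by move=> z _; rewrite lee_fin divr_ge0 ?powR_ge0.
  + by move=> z [z1 z2]; split; exact: UU'.
Qed.

(** Two points contribute only if one of them lies in [S], and then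
[|f x - f y| <= min 1 (|x - y| / r)]. *)
Lemma gagliardo_lipschitz_lty (s p r : R) (S : set V) (f : V -> R) :
  0 < s -> s < 1 -> 0 < p -> 0 < r ->
  measurable S -> (mu S < +oo)%E -> measurable_fun setT f ->
  (forall x, 0 <= f x <= 1) -> (forall x, ~ S x -> f x = 0) ->
  (forall x y, `|f x - f y| <= `|x - y| / r) ->
  (gagliardo s p setT f < +oo)%E.
Proof.
move=> s0 s1 p0 r0 mS Soo mf f01 fS flip; rewrite gagliardo_setT.
have m1 : measurable_fun setT (\1_S : V -> R) by exact: measurable_indic.
apply: le_lt_trans (integral_truncated_kernel_lty s0 s1 p0 r0 m1 _ _); first last.
- by rewrite integral_indic// setIT.
- by [].
apply: ge0_le_integral => //.
- by move=> z _; rewrite lee_fin divr_ge0 ?powR_ge0.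
- by apply/measurable_EFinP; exact: measurable_gagliardo.
- apply/measurable_EFinP/measurable_funM; last exact: measurable_truncated_kernel.
  by apply: measurable_funD; [exact: measurable_comp_fst|exact: measurable_comp_snd].
move=> [x y] _ /=; rewrite lee_fin /truncated_kernel/= mulrA.
rewrite ler_wpM2r ?invr_ge0 ?powR_ge0//.
have [Sxy|] := pselect (S x \/ S y); last first.
  move=> /not_orP[Sx Sy]; rewrite !fS// subrr normr0 powR0 ?gt_eqF//.
  by rewrite mulr_ge0 ?addr_ge0 ?powR_ge0.
apply: (@le_trans _ _ (Num.min 1 (enorm (x - y) / r) `^ p)).
  apply: le_powR2 => //; first exact: ltW.
  rewrite le_min; apply/andP; split.
    have /andP[? ?] := f01 x; have /andP[? ?] := f01 y.
    by rewrite ler_distl; apply/andP; split; lra.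
  rewrite (le_trans (flip x y))// ler_pM2r ?invr_gt0//; exact: norm_le_enorm.
rewrite ler_peMl ?powR_ge0// !indicE.
case: Sxy => Sz; first by rewrite mem_set// lerDl.
by rewrite (mem_set (u := y))// lerDr.
Qed.

Lemma gagliardoZ (s p e : R) (f : V -> R) : 0 <= e -> measurable_fun setT f ->
  gagliardo s p setT (fun x => e * f x) = ((e `^ p)%:E * gagliardo s p setT f)%E.
Proof.
move=> e0 mf; rewrite !gagliardo_setT -ge0_integralZl//; first last.
- by rewrite lee_fin powR_ge0.
- by move=> z _; rewrite lee_fin divr_ge0 ?powR_ge0.
- by apply/measurable_EFinP; exact: measurable_gagliardo.
apply: eq_integral => z _; rewrite -EFinM; congr EFin.
by rewrite -mulrBr normrM (ger0_norm e0) powRM// mulrA.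
Qed.

(** A Lebesgue number argument: some neighbourhood of [A] of constant width is
contained in [U]. *)
Lemma compact_open_thickening (A U : set V) : compact (closure A) ->
  open U -> closure A `<=` U ->
  exists2 r, 0 < r & forall x y, A x -> `|x - y| < r -> U y.
Proof.
move=> /compact_near_coveringP cA oU AU.
have : \forall r \near (0 : R)^'+, closure A `<=` [set x | ball x r `<=` U].
  apply: cA => x /AU Ux.
  have /nbhs_ballP[e/= e0 eU] : nbhs x U by exact: open_nbhs_nbhs.
  exists (ball x (e / 2), [set r | 0 < r < e / 2]) => /=.
    split; first by apply: nbhsx_ballx; rewrite divr_gt0.
    near=> r; apply/andP; split; near: r; first exact: nbhs_right_gt.
    by apply: nbhs_right_lt; rewrite divr_gt0.
  move=> [y r] /= [xy /andP[r0 re]] z yz; apply: eU.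
  rewrite [e]splitr; apply: ball_triangle xy _.
  by apply: le_ball yz; exact: ltW.
move=> h; near (0 : R)^'+ => r; exists r => // x y Ax xy.
have : closure A `<=` [set x | ball x r `<=` U] by near: r.
move=> /(_ x (subset_closure Ax)); apply.
by rewrite -ball_normE.
Unshelve. all: by end_near. Qed.

End product_estimates.

(** * Truncations as test functions *)

Section truncation.
Context {R : realType} {N : nat}.
Local Notation V := 'rV[R]_N.
Local Notation mu := (lebesgue_rV R N).
Implicit Types (s p : R) (S U Omega : set V) (u w phi c : V -> R).

(** Multiplying by the indicator makes the function vanish everywhere off [S], as
membership in the test space demands, although [w <= u] is only known almost
everywhere there. *)
Definition truncation S w u (x : V) : R := \1_S x * Num.max 0 (w x - u x).

Lemma truncation_ge0 S w u x : 0 <= truncation S w u x.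
Proof. by rewrite mulr_ge0// le_max lexx. Qed.

Lemma truncation_out S w u x : ~ S x -> truncation S w u x = 0.
Proof. by move=> Sx; rewrite /truncation indicE memNset// mul0r. Qed.

Lemma truncation_in S w u x : S x ->
  truncation S w u x = Num.max 0 (w x - u x).
Proof. by move=> Sx; rewrite /truncation indicE mem_set// mul1r. Qed.

Lemma measurable_truncation S w u : measurable S ->
  measurable_fun setT w -> measurable_fun setT u ->
  measurable_fun setT (truncation S w u).
Proof.
move=> mS mw muu; apply: measurable_funM; first exact: measurable_indic.
by apply: measurable_maxr => //; exact: measurable_funB.
Qed.

Lemma truncation_ae S w u :
  {ae mu, forall x, ~ S x -> w x <= u x} ->
  {ae mu, forall x, truncation S w u x = Num.max 0 (w x - u x)}.
Proof.
apply: filterS => x wu; have [Sx|Sx] := pselect (S x).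
  exact: truncation_in.
by rewrite truncation_out// max_l// subr_le0 wu.
Qed.

Lemma le_dist_max0 (a b : R) : `|Num.max 0 a - Num.max 0 b| <= `|a - b|.
Proof.
case: (leP 0 a) => a0; case: (leP 0 b) => b0 //.
- by rewrite subr0 !ger0_norm//; lra.
- by rewrite sub0r normrN distrC !ger0_norm//; lra.
- by rewrite subrr normr0.
Qed.

(** If the [r]-neighbourhood of [S] is contained in [U], then two points at distance
less than [r], one of them in [S], both lie in [U], where the increments of
[truncation S w u] are controlled by those of [w] and [u]. At distance at least
[r] the kernel is the truncated one, and the increments to the power [p] are
bounded by the sum of the two values to the power [p]. *)
Lemma in_W_zero_truncation s p S U u w :
  0 < s -> s < 1 -> 1 < p ->
  open S -> compactly_inside S U -> open U -> in_W s p U u ->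
  measurable_fun setT u -> measurable_fun setT w ->
  (Lp_energy p setT w < +oo)%E -> (gagliardo s p setT w < +oo)%E ->
  {ae mu, forall x, ~ S x -> w x <= u x} ->
  in_W_zero s p S (truncation S w u).
Proof.
move=> s0 s1 p1 oS [cS SU] oU [[_ up] ug] muu mw wp wg wu.
set phi := truncation S w u.
have p0 : 0 < p by lra.
have mS := open_measurable_rV oS; have mU := open_measurable_rV oU.
have mphi : measurable_fun setT phi by exact: measurable_truncation.
have phiE := truncation_ae wu.
have phi0 x : 0 <= phi x by exact: truncation_ge0.
have phip x : `|phi x| `^ p <=
    2 `^ p * (`|w x| `^ p + \1_U x * `|u x| `^ p).
  have [Sx|Sx] := pselect (S x); last first.
    by rewrite /phi truncation_out// normr0 powR0 ?gt_eqF.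
  rewrite indicE (mem_set (SU _ (subset_closure Sx))) mul1r.
  apply: le_trans (powRD_le (ltW p0) (normr_ge0 _) (normr_ge0 _)).
  apply: le_powR2 => //; first exact: ltW.
  rewrite ger0_norm// /phi truncation_in// ge_max addr_ge0//=.
  by rewrite (le_trans (ler_norm _))// ler_normB.
have phiLp : (Lp_energy p setT phi < +oo)%E.
  have mwp := measurable_norm_powR p mw.
  have mup : measurable_fun setT (fun x => \1_U x * `|u x| `^ p).
    by apply: measurable_funM; [exact: measurable_indic|exact: measurable_norm_powR].
  apply: (@le_lt_trans _ _ (\int[mu]_x
      ((2 `^ p)%:E * ((`|w x| `^ p)%:E + (\1_U x * `|u x| `^ p)%:E)))%E).
    apply: ge0_le_integral => //.
    - by apply/measurable_EFinP; exact: measurable_norm_powR.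
    - apply: emeasurable_funM => //; apply: emeasurable_funD; exact/measurable_EFinP.
    - by move=> x _; rewrite -EFinD -EFinM lee_fin.
  rewrite ge0_integralZl//.
  - rewrite ge0_integralD//; last 2 first.
    + exact/measurable_EFinP.
    + exact/measurable_EFinP.
    rewrite -integral_EFin_indic lte_mul_pinfty//.
    by apply: lte_add_pinfty; [exact: wp|exact: up].
  - by apply: emeasurable_funD; exact/measurable_EFinP.
  - by move=> x _; rewrite adde_ge0 ?lee_fin ?mulr_ge0 ?powR_ge0.
have [r r0 rS] := compact_open_thickening cS oU SU.
have phig : (gagliardo s p setT phi < +oo)%E.
  rewrite gagliardo_setT.
  pose K (z : V * V) := enorm (z.1 - z.2) `^ (N%:R + s * p).
  have K0 z : 0 <= (K z)^-1 by rewrite invr_ge0 powR_ge0.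
  pose far (z : V * V) := (`|phi z.1| `^ p + `|phi z.2| `^ p) *
    truncated_kernel s p r z.
  pose near1 (z : V * V) := `|w z.1 - w z.2| `^ p / K z.
  pose near2 (z : V * V) := \1_(U `*` U) z * (`|u z.1 - u z.2| `^ p / K z).
  have far0 z : 0 <= far z.
    by rewrite mulr_ge0 ?addr_ge0 ?powR_ge0 ?truncated_kernel_ge0.
  have near10 z : 0 <= near1 z by rewrite mulr_ge0 ?powR_ge0.
  have near20 z : 0 <= near2 z by rewrite !mulr_ge0 ?powR_ge0.
  have mfar : measurable_fun setT far.
    apply: measurable_funM; last exact: measurable_truncated_kernel.
    apply: measurable_funD.
      exact: (measurable_comp_fst (measurable_norm_powR p mphi)).
    exact: (measurable_comp_snd (measurable_norm_powR p mphi)).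
  have mnear1 : measurable_fun setT near1 by exact: measurable_gagliardo.
  have mnear2 : measurable_fun setT near2.
    apply: measurable_funM; last exact: measurable_gagliardo.
    by apply: measurable_indic; exact: measurableX.
  apply: (@le_lt_trans _ _ (\int[mu \x mu]_z
      ((2 `^ p)%:E * ((near1 z)%:E + (near2 z)%:E) + (far z)%:E))%E).
    apply: ae_ge0_le_integral => //.
    - by move=> z _; rewrite lee_fin divr_ge0 ?powR_ge0.
    - by apply/measurable_EFinP; exact: measurable_gagliardo.
    - by move=> z _; rewrite adde_ge0 ?mule_ge0 ?adde_ge0 ?lee_fin ?powR_ge0.
    - apply: emeasurable_funD; last exact/measurable_EFinP.
      apply: emeasurable_funM => //; apply: emeasurable_funD; exact/measurable_EFinP.
    - have := ae_fst phiE; have := ae_snd phiE.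
      apply: filterS2 => -[x y] /= phiy phix _.
      rewrite [leRHS](_ : _ =
        (2 `^ p * (near1 (x, y) + near2 (x, y)) + far (x, y))%:E) ?lee_fin//.
      have [Sxy|] := pselect (S x \/ S y); last first.
        move=> /not_orP[Sx Sy]; rewrite /phi !truncation_out// subrr normr0.
        rewrite powR0 ?gt_eqF// mul0r.
        by rewrite addr_ge0// mulr_ge0 ?powR_ge0 ?addr_ge0.
      have [xyr|rxy] := ltP (enorm (x - y)) r.
        have xyr' : `|x - y| < r by exact: le_lt_trans (norm_le_enorm _) xyr.
        have [Ux Uy] : U x /\ U y.
          case: Sxy => Sz; split.
          - exact: SU (subset_closure Sz).
          - exact: rS xyr'.
          - by apply: rS Sz _; rewrite distrC.
          - exact: SU (subset_closure Sz).
        rewrite ler_wpDr// /near2 indicE mem_set//= mul1r /near1/= -mulrDl mulrA.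
        rewrite ler_wpM2r ?invr_ge0 ?powR_ge0//.
        apply: le_trans (powRD_le (ltW p0) (normr_ge0 _) (normr_ge0 _)).
        apply: le_powR2 => //; first exact: ltW.
        rewrite /phi phix phiy (le_trans (le_dist_max0 _ _))//.
        have -> : w x - u x - (w y - u y) = (w x - w y) - (u x - u y) by ring.
        exact: ler_normB.
      rewrite ler_wpDl ?mulr_ge0 ?powR_ge0 ?addr_ge0//.
      rewrite /far /truncated_kernel/= min_l; last by rewrite ler_pdivlMr// mul1r.
      rewrite pow1R mul1r ler_wpM2r ?invr_ge0 ?powR_ge0//.
      by rewrite !(ger0_norm (phi0 _)) powR_dist_le// ltW.
  rewrite ge0_integralD//; first last.
  - exact/measurable_EFinP.
  - by move=> z _; rewrite lee_fin.
  - apply: emeasurable_funM => //; apply: emeasurable_funD; exact/measurable_EFinP.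
  - by move=> z _; rewrite mule_ge0 ?adde_ge0 ?lee_fin ?powR_ge0.
  rewrite ge0_integralZl//; first last.
  - by move=> z _; rewrite adde_ge0 ?lee_fin.
  - apply: emeasurable_funD; exact/measurable_EFinP.
  rewrite ge0_integralD//; first last.
  - exact/measurable_EFinP.
  - by move=> z _; rewrite lee_fin.
  - exact/measurable_EFinP.
  - by move=> z _; rewrite lee_fin.
  apply: lte_add_pinfty.
    rewrite lte_mul_pinfty// ?lee_fin ?powR_ge0//.
    apply: lte_add_pinfty; first by rewrite gagliardo_setT in wg.
    rewrite /near2 -(integral_EFin_indic (mu \x mu)%E (U `*` U)).
    exact: ug.
  apply: (integral_truncated_kernel_lty (a := fun x => `|phi x| `^ p)) => //.
  exact: measurable_norm_powR.
have phiW : in_W s p setT phi by split.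
split; [|by move=> x; exact: truncation_out|exact: phiW].
exact: (in_W_sub mS measurableT (@subsetT _ S) mphi phiW).
Qed.

(** A finite lower bound on the difference excludes the case where both terms are
infinite, the difference being then [-oo] by convention. *)
Lemma lee_of_sub_bound (A P M g : \bar R) : (0 <= A)%E -> A \is a fin_num ->
  (- A <= P - M)%E -> (P <= g)%E -> (M <= g + A)%E.
Proof.
case: A P M g => [a| |] [P| |] [M| |] [g| |] // _ _.
- by rewrite -EFinN -EFinB -EFinD !lee_fin; lra.
- by move=> _ _; exact: leey.
- by move=> _ _; exact: leNye.
- by move=> _ _; exact: leey.
Qed.

(** The positive part of the integrand of the form is at most
[|w x - w y|^p / |x - y|^(N+sp)], and its negative part is at least
[d / |x - y|^(N+sp)] on [G]. As the form is the difference of the two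
integrals, a lower bound on it bounds the second by the first plus [A]. *)
Lemma truncation_energy s p u w phi (A d : R) (G : set (V * V)) :
  1 < p -> 0 <= A -> 0 <= d ->
  measurable_fun setT u -> measurable_fun setT w -> measurable_fun setT phi ->
  {ae mu, forall x, phi x = Num.max 0 (w x - u x)} ->
  ((- A)%:E <= frac_plap_form s p u phi)%E ->
  measurable G ->
  {ae (mu \x mu)%E, forall z, G z ->
    spow p (u z.1 - u z.2) * (phi z.1 - phi z.2) <= - d} ->
  (d%:E * \int[mu \x mu]_(z in G) (enorm (z.1 - z.2) `^ (N%:R + s * p))^-1%:E
    <= gagliardo s p setT w + A%:E)%E.
Proof.
move=> p1 A0 d0 muu mw mphi phiE hA mG hG.
pose K (z : V * V) := enorm (z.1 - z.2) `^ (N%:R + s * p).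
have K0 z : 0 <= (K z)^-1 by rewrite invr_ge0 powR_ge0.
pose I z := spow p (u z.1 - u z.2) * (phi z.1 - phi z.2) / K z.
have mI : measurable_fun setT I.
  apply: measurable_div_dist_powR; apply: measurable_funM; last exact: measurable_diff.
  apply: measurable_funM; last exact: measurable_diff.
  by apply: measurable_norm_powR; exact: measurable_diff.
have meI : measurable_fun setT (EFin \o I) by exact/measurable_EFinP.
move: hA; rewrite /frac_plap_form -/(I _) integralE EFinN => hA.
apply: le_trans (lee_of_sub_bound _ _ hA _) => //; last first.
  rewrite gagliardo_setT; apply: ae_ge0_le_integral => //.
  - exact: measurable_funepos.
  - by move=> z _; rewrite lee_fin divr_ge0 ?powR_ge0.
  - by apply/measurable_EFinP; exact: measurable_gagliardo.
  - have := ae_fst phiE; have := ae_snd phiE.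
    apply: filterS2 => -[x y] /= phiy phix _.
    rewrite funeposE/= -EFin_max lee_fin ge_max; apply/andP; split.
      by rewrite ler_wpM2r ?invr_ge0 ?powR_ge0// phix phiy spow_truncation.
    by rewrite divr_ge0 ?powR_ge0.
have mK : measurable_fun setT (fun z => \1_G z * (K z)^-1).
  apply: measurable_funM; first exact: measurable_indic.
  under eq_fun do rewrite -powRN; exact: measurable_dist_powR.
rewrite integral_EFin_indic -ge0_integralZl//; first last.
- by move=> z _; rewrite lee_fin mulr_ge0// K0.
- exact/measurable_EFinP.
apply: ae_ge0_le_integral => //.
- by move=> z _; rewrite mule_ge0// lee_fin// mulr_ge0// K0.
- by apply: emeasurable_funM => //; exact/measurable_EFinP.
- exact: measurable_funeneg.
apply: filterS hG => z hz _; rewrite funenegE/= -EFinM -EFin_max lee_fin.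
have [Gz|Gz] := pselect (G z); last first.
  by rewrite indicE memNset// mul0r mulr0 le_max lexx orbT.
rewrite indicE mem_set// mul1r le_max; apply/orP; left.
by rewrite -mulNr ler_wpM2r ?invr_ge0 ?powR_ge0// lerNr hz.
Qed.

(** The integrand is negative only where [0 < u <= w], and there
[u^(p-1) (w - u) <= w^(p-1) w]. *)
Lemma functional_truncation_ge p S Omega c u w :
  1 < p -> measurable Omega ->
  in_L1_loc Omega c -> {ae mu, forall x, Omega x -> c x <= 0} ->
  measurable_fun setT w -> (forall x, 0 <= w x) ->
  mu.-integrable Omega
    (fun x => (c x * spow p (u x) * truncation S w u x)%:E) ->
  (- (\int[mu]_(x in Omega) (`|c x| * w x `^ p)%:E) <=
   (functional_of Omega (fun x => c x * spow p (u x))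
      (truncation S w u))%:E)%E.
Proof.
move=> p1 mO [mc _] c0 mw w0 ih.
have p0 : 0 < p by lra.
rewrite /functional_of/Rintegral fineK; last exact: integrable_fin_num.
rewrite integralE; apply: (@le_trans _ _
  (- (\int[mu]_(x in Omega)
    (fun x => (c x * spow p (u x) * truncation S w u x)%:E)^\- x))%E); last first.
  by rewrite leeDr// integral_ge0.
rewrite leeN2; have mi := measurable_int _ ih.
apply: ae_ge0_le_integral => //.
- exact: measurable_funeneg.
- by move=> x _; rewrite lee_fin mulr_ge0 ?powR_ge0.
- apply/measurable_EFinP; apply: measurable_funM; first exact: measurableT_comp.
  by apply: (measurableT_comp (measurable_powR p)); exact: measurable_funTS.
apply: filterS c0 => x cx Ox; have {}cx := cx Ox.
rewrite funenegE/= -EFin_max lee_fin ge_max; apply/andP; split; last first.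
  by rewrite mulr_ge0 ?powR_ge0.
rewrite ler0_norm// -(mulrA (c x)) -mulNr ler_wpM2l ?oppr_ge0//.
have [Sx|Sx] := pselect (S x); last by rewrite truncation_out// mulr0 powR_ge0.
rewrite truncation_in//.
case: (leP 0 (w x - u x)) => wu; last by rewrite mulr0 powR_ge0.
have [ux|ux] := leP (u x) 0.
  by rewrite (@le_trans _ _ 0) ?powR_ge0// mulr_le0_ge0// spow_le0.
rewrite -mulr_powRB1// mulrC spow_ge0E//; last exact: ltW.
apply: ler_pM => //; rewrite ?powR_ge0//; first by lra.
by apply: le_powR2; lra.
Qed.

(** Disjointness keeps the product off the diagonal, where the kernel
vanishes by convention. *)
Lemma kernel_separates s p (Z Y : set V) : measurable Z -> measurable Y ->
  (forall x, Z x -> Y x -> False) ->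
  (\int[mu \x mu]_(z in Z `*` Y)
     (enorm (z.1 - z.2) `^ (N%:R + s * p))^-1%:E = 0)%E ->
  mu Z = 0%E \/ mu Y = 0%E.
Proof.
move=> mZ mY ZY; rewrite integral_EFin_indic => int0.
have mG : measurable (Z `*` Y) by exact: measurableX.
pose f z := (\1_(Z `*` Y) z * (enorm (z.1 - z.2) `^ (N%:R + s * p))^-1)%:E.
have mf : measurable_fun setT f.
  apply/measurable_EFinP; apply: measurable_funM; first exact: measurable_indic.
  under eq_fun do rewrite -powRN; exact: measurable_dist_powR.
have f0 z : (0 <= f z)%E by rewrite lee_fin mulr_ge0// invr_ge0 powR_ge0.
have : ae_eq (mu \x mu)%E setT f (cst 0%E).
  apply/ae_eq_integral_abs => //; rewrite -[RHS]int0; apply: eq_integral => z _.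
  by rewrite gee0_abs.
move=> aef.
have neg : (mu \x mu)%E.-negligible (Z `*` Y).
  apply: negligibleS aef => -[x y] /= [Zx Yy] /(_ I); apply/eqP.
  rewrite /f/= indicE mem_set// mul1r eqe invr_eq0 gt_eqF// powR_gt0// enorm_gt0//.
  by rewrite subr_eq0; apply/eqP => xy; apply: (ZY x) => //; rewrite xy.
have ZY0 : (mu Z * mu Y = 0)%E.
  rewrite -[RHS](measure_negligible mG neg); apply/esym.
  exact: product_measure1E.
move/eqP : ZY0; rewrite mule_eq0 => /orP[]/eqP; by [left|right].
Qed.

End truncation.

(** * The minimum principle *)

Section minimum_principle.
Context {R : realType} {N : nat}.
Local Notation V := 'rV[R]_N.
Local Notation mu := (lebesgue_rV R N).
Implicit Types (s p : R) (S Omega : set V) (u w c : V -> R).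

(** The consequence of the super-solution inequality on which both parts of the
proof rely. It is stated for subsets [S] of [Omega], because for unbounded
[Omega] the inequality is only available on bounded open subsets. *)
Lemma supersolution_energy s p Omega S c u w (A d : R) (G : set (V * V)) :
  0 < s -> s < 1 -> 1 < p -> open Omega ->
  in_L1_loc Omega c -> {ae mu, forall x, Omega x -> c x <= 0} ->
  weak_super_potential s p Omega c u ->
  open S -> bounded_set S -> S `<=` Omega ->
  measurable_fun setT w -> (forall x, 0 <= w x) ->
  (Lp_energy p setT w < +oo)%E -> (gagliardo s p setT w < +oo)%E ->
  {ae mu, forall x, ~ S x -> w x <= u x} ->
  (\int[mu]_(x in Omega) (`|c x| * w x `^ p)%:E <= A%:E)%E ->
  measurable G -> 0 <= d ->
  {ae (mu \x mu)%E, forall z, G z ->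
    spow p (u z.1 - u z.2) *
      (truncation S w u z.1 - truncation S w u z.2) <= - d} ->
  (d%:E * \int[mu \x mu]_(z in G) (enorm (z.1 - z.2) `^ (N%:R + s * p))^-1%:E
    <= gagliardo s p setT w + A%:E)%E.
Proof.
move=> s0 s1 p1 oO cL c0 [[[muu _] uW _] [fint _] [_ wbd wubd]] oS bS SO.
move=> mw w0 wp wg wu cA mG d0 hG.
have mS := open_measurable_rV oS; have mO := open_measurable_rV oO.
have mphi : measurable_fun setT (truncation S w u).
  exact: measurable_truncation.
have [U [oU SU UW]] := uW _ bS SO.
have phiS : in_W_zero s p S (truncation S w u).
  exact: in_W_zero_truncation UW muu mw wp wg wu.
have phiO : in_W_zero s p Omega (truncation S w u).
  have [_ phi0 phiW] := phiS; split; [|by move=> x Ox; apply: phi0 => /SO|exact: phiW].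
  exact: (in_W_sub mO measurableT (@subsetT _ Omega) mphi phiW).
have phiae : {ae mu, forall x, 0 <= truncation S w u x}.
  by apply: aeW => x; exact: truncation_ge0.
have test : ((functional_of Omega (fun x => c x * spow p (u x))
    (truncation S w u))%:E <= frac_plap_form s p u (truncation S w u))%E.
  have [bO|bO] := pselect (bounded_set Omega).
    by have [_] := wbd bO; apply.
  by have [_ /(_ S oS bS SO)[_]] := wubd bO; apply.
have A0 : 0 <= A.
  rewrite -lee_fin (le_trans _ cA)// integral_ge0// => x _.
  by rewrite lee_fin mulr_ge0 ?powR_ge0.
apply: (truncation_energy p1 A0 d0 muu mw mphi (truncation_ae wu) _ mG hG).
apply: le_trans test; apply: le_trans (functional_truncation_ge p1 mO cL c0 mw w0 _).
  by rewrite EFinN leeN2.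
exact: fint.
Qed.

Lemma lebesgue_rV_setC_bounded_neq0 (A : set V) : (0 < N)%N ->
  measurable A -> bounded_set A -> mu (~` A) != 0%E.
Proof.
move=> N0 mA /bounded_set_sub_ball[r r0 Ar].
(* The coordinates of the points of this ball all exceed [r]. *)
pose q : V := const_mx (r + 1).
have qA : ball q 1 `<=` ~` A.
  move=> x; rewrite -ball_normE/= => /normr_rV_ltP -/(_ ltr01) qx /Ar.
  rewrite -ball_normE/= sub0r normrN => /normr_rV_ltP -/(_ r0) xr.
  have := qx (Ordinal N0); have := xr (Ordinal N0).
  rewrite !mxE => /(le_lt_trans (ler_norm _)) h.
  by rewrite ltr_distl => /andP[]; lra.
have : (0 < mu (~` A))%E.
  apply: (@lt_le_trans _ _ (mu (ball q 1))).
    by rewrite lebesgue_rV_ball// lte_fin exprn_gt0// mulr_gt0.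
  apply: le_measure; rewrite ?inE//; first exact: measurable_ball_rV.
  exact: measurableC.
by move=> h; rewrite gt_eqF.
Qed.

Lemma gagliardo0 s p : 0 < p -> gagliardo s p setT (cst 0 : V -> R) = 0%E.
Proof.
move=> p0; rewrite gagliardo_setT integral0_eq// => z _.
by rewrite /= subrr normr0 powR0 ?gt_eqF// mul0r.
Qed.

Lemma ae_le0_of_superlevel (f : V -> R) (D : set V) :
  (forall n : nat, mu [set x | D x /\ n.+1%:R^-1 <= f x] = 0%E) ->
  (forall n : nat, measurable [set x | D x /\ n.+1%:R^-1 <= f x]) ->
  {ae mu, forall x, D x -> f x <= 0}.
Proof.
move=> f0 mf.
have : {ae mu, forall x, forall n : nat, ~ (D x /\ n.+1%:R^-1 <= f x)}.
  apply/ae_foralln => n; exists [set x | D x /\ n.+1%:R^-1 <= f x].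
  by split; [exact: mf|exact: f0|move=> x /= /contrapT].
apply: filterS => x h Dx; rewrite leNgt; apply/negP => fx.
have [n _ /(_ n (leqnn n))/= hn] := near_infty_natSinv_lt (PosNum fx).
by apply: (h n); split => //; exact: ltW.
Qed.

Lemma measurable_superlevel (f : V -> R) (D : set V) (a : R) :
  measurable_fun setT f -> measurable D ->
  measurable [set x | D x /\ a <= f x].
Proof.
move=> mf mD.
exact: (measurable_fun_le mD (measurable_cst a) (measurable_funTS mf)).
Qed.

Lemma supersolution_ge0 s p Omega c u :
  (0 < N)%N -> 0 < s -> s < 1 -> 1 < p -> open Omega -> bounded_set Omega ->
  in_L1_loc Omega c -> {ae mu, forall x, Omega x -> c x <= 0} ->
  weak_super_potential s p Omega c u ->
  {ae mu, forall x, ~ Omega x -> 0 <= u x} ->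
  {ae mu, forall x, 0 <= u x}.
Proof.
move=> N0 s0 s1 p1 oO bO cL c0 wsp u0.
have p0 : 0 < p by lra.
have mO := open_measurable_rV oO.
have [[[muu _] _ _] _ _] := wsp.
have mNu : measurable_fun setT (fun x => - u x).
  exact: measurableT_comp.
pose Z n := [set x | Omega x /\ n.+1%:R^-1 <= - u x].
have mZ n : measurable (Z n) by exact: measurable_superlevel.
have Z0 n : mu (Z n) = 0%E.
  pose t : R := n.+1%:R^-1.
  have t0 : 0 < t by rewrite invr_gt0.
  have := @supersolution_energy s p Omega Omega c u (cst 0) 0 (t `^ (p - 1) * t)
    (Z n `*` ~` Omega) s0 s1 p1 oO cL c0 wsp oO bO (@subset_refl _ _).
  have Lp0 : Lp_energy p setT (cst 0 : V -> R) = 0%E.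
    by rewrite /Lp_energy integral0_eq// => x _; rewrite /= normr0 powR0 ?gt_eqF.
  rewrite gagliardo0// Lp0 adde0.
  have int0 : (\int[mu]_(x in Omega) (`|c x| * (cst 0 : V -> R) x `^ p)%:E = 0)%E.
    by apply: integral0_eq => x _ /=; rewrite powR0 ?mulr0 ?gt_eqF.
  rewrite int0.
  have d0 : 0 < t `^ (p - 1) * t by rewrite mulr_gt0 ?powR_gt0.
  move=> /(_ (measurable_cst (0 : R)) (fun=> lexx (0 : R)) (ltry _) (ltry _) u0 (lexx _)).
  move=> /(_ (measurableX (mZ n) (measurableC mO)) (ltW d0)) energy.
  have h : ((t `^ (p - 1) * t)%:E * \int[mu \x mu]_(z in Z n `*` ~` Omega)
      (enorm (z.1 - z.2) `^ (N%:R + s * p))^-1%:E <= 0)%E.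
    apply: energy; have := ae_snd u0.
    apply: filterS => -[x y] /= uy [[Ox ux] Oy].
    rewrite truncation_in// truncation_out// /cst/= sub0r subr0.
    have {}uy := uy Oy.
    have tu : t <= - u x by [].
    rewrite max_r; last by rewrite (le_trans (ltW t0)).
    rewrite -mulNr; apply: (@le_trans _ _ (- t `^ (p - 1) * - u x)).
      rewrite ler_wpM2r//; first by rewrite (le_trans (ltW t0)).
      rewrite -(spow_ge0E p1 (ltW t0)) -spowN; apply: le_spow => //; lra.
    by rewrite ler_wnM2l// oppr_le0 powR_ge0.
  have /kernel_separates : (\int[mu \x mu]_(z in Z n `*` ~` Omega)
      (enorm (z.1 - z.2) `^ (N%:R + s * p))^-1%:E = 0)%E.
    apply/eqP; rewrite eq_le integral_ge0 ?andbT; last first.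
      by move=> z _; rewrite lee_fin invr_ge0 powR_ge0.
    by rewrite -(pmule_rle0 (x := (t `^ (p - 1) * t)%:E)) ?lte_fin.
  move=> /(_ (mZ n) (measurableC mO))[|//|/eqP].
    by move=> x [].
  by rewrite (negPf (lebesgue_rV_setC_bounded_neq0 N0 mO bO)).
have := ae_le0_of_superlevel Z0 mZ.
apply: filterS2 u0 => x u0 ux; have [Ox|Ox] := pselect (Omega x).
  by have := ux Ox; rewrite oppr_le0.
exact: u0.
Qed.

(** After division by [e], the left-hand side does not depend on [e] while the
right-hand side tends to [0]. *)
Lemma eq0_of_power_gap (p a b C : R) (X : \bar R) :
  1 < p -> 0 < a -> 0 < b -> (0 <= X)%E ->
  (forall e : R, 0 < e -> e <= b -> ((a * e)%:E * X <= (e `^ p * C)%:E)%E) ->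
  X = 0%E.
Proof.
move=> p1 a0 b0 X0 hX.
have p10 : 0 < p - 1 by lra.
have Xfin : X \is a fin_num.
  rewrite ge0_fin_numE// ltey; apply/eqP => XE.
  have := hX b b0 (lexx b); rewrite XE gt0_muley ?lte_fin ?mulr_gt0//.
move: X0 hX; rewrite -(fineK Xfin); set x := fine X; rewrite lee_fin => x0 hX.
congr EFin; apply/eqP; rewrite eq_le x0 andbT leNgt; apply/negP => {}x0.
have hx e : 0 < e -> e <= b -> a * x <= e `^ (p - 1) * C.
  move=> e0 eb; have := hX e e0 eb; rewrite -EFinM lee_fin.
  have -> : e `^ p = e * e `^ (p - 1) by rewrite mulr_powRB1//; lra.
  have -> : a * e * x = e * (a * x) by ring.
  by rewrite -mulrA ler_pM2l.
have ax0 : 0 < a * x by rewrite mulr_gt0.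
have C0 : 0 < C.
  have := lt_le_trans ax0 (hx b b0 (lexx b)).
  by rewrite pmulr_rgt0// powR_gt0.
have c0 : 0 < a * x / (2 * C) by rewrite divr_gt0// mulr_gt0.
(* This value makes [e^(p-1) C] at most [a x / 2]. *)
pose e := Num.min b ((a * x / (2 * C)) `^ (p - 1)^-1).
have e0 : 0 < e by rewrite lt_min b0 powR_gt0.
have : e `^ (p - 1) <= a * x / (2 * C).
  have -> : a * x / (2 * C) = ((a * x / (2 * C)) `^ (p - 1)^-1) `^ (p - 1).
    by rewrite -powRrM mulVf ?gt_eqF// powRr1// ltW.
  apply: le_powR2; [exact: ltW|exact: ltW|].
  by rewrite ge_min lexx orbT.
rewrite -(ler_pM2r C0) => /(le_trans (hx e e0 _)); rewrite ge_min lexx => /(_ isT).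
have -> : a * x / (2 * C) * C = a * x / 2 by field; rewrite gt_eqF.
lra.
Qed.

Definition cutoff (q : V) (r : R) (x : V) : R :=
  Num.max 0 (Num.min 1 (2 - `|q - x| / r)).

Section cutoff.
Context (q : V) (r : R) (r0 : 0 < r).

Lemma cutoff_itv x : 0 <= cutoff q r x <= 1.
Proof.
by rewrite /cutoff le_max lexx/= ge_max ler01 ge_min lexx.
Qed.

Lemma cutoff_in x : ball q r x -> cutoff q r x = 1.
Proof.
rewrite -ball_normE/= => qx; rewrite /cutoff min_l ?max_r//.
have : `|q - x| / r <= 1 by rewrite ler_pdivrMr// mul1r ltW.
lra.
Qed.

Lemma cutoff_out x : ~ ball q (2 * r) x -> cutoff q r x = 0.
Proof.
rewrite -ball_normE/= => /negP; rewrite -leNgt => qx.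
rewrite /cutoff max_l// ge_min; apply/orP; right.
by rewrite subr_le0 ler_pdivlMr.
Qed.

Lemma cutoff_lipschitz x y :
  `|cutoff q r x - cutoff q r y| <= `|x - y| / r.
Proof.
apply: (le_trans (le_dist_max0 _ _)).
have : `| `|q - x| / r - `|q - y| / r | <= `|x - y| / r.
  have r'0 : 0 <= r^-1 by rewrite invr_ge0 ltW.
  rewrite -mulrBl normrM (ger0_norm r'0).
  rewrite ler_pM2r ?invr_gt0// (le_trans (ler_dist_dist _ _))//.
  by rewrite opprB addrC addrA subrK distrC.
move: (`|q - x| / r) (`|q - y| / r) (`|x - y| / r) => a b c abc.
have c0 : 0 <= c by exact: le_trans abc.
move: abc; rewrite !ler_distl => /andP[h1 h2].
case: (leP 1 (2 - a)) => ?; case: (leP 1 (2 - b)) => ?; apply/andP; split; lra.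
Qed.

Lemma measurable_cutoff : measurable_fun setT (cutoff q r).
Proof.
apply: continuous_measurable_rV => x.
apply/(@cvgrPdist_lt _ _ _ (nbhs x) (@nbhs_filter _ x)) => e e0.
near=> y; apply: (le_lt_trans (cutoff_lipschitz _ _)).
rewrite ltr_pdivrMr//; near: y.
apply/nbhs_ballP; exists (e * r) => /=; first by rewrite mulr_gt0.
by move=> y; rewrite -ball_normE.
Unshelve. all: by end_near. Qed.

End cutoff.

(** Zeros of [u] interact with all points where [u] is positive, however far:
the cutoff [e eta] costs [e^p] but the interaction is worth [e]. *)
Lemma supersolution_local_dichotomy s p Omega c u (q : V) (r d : R) :
  0 < s -> s < 1 -> 1 < p -> open Omega ->
  in_L1_loc Omega c -> {ae mu, forall x, Omega x -> c x <= 0} ->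
  weak_super_potential s p Omega c u ->
  {ae mu, forall x, 0 <= u x} ->
  0 < r -> ball q (3 * r) `<=` Omega -> 0 < d ->
  mu (ball q r `&` [set x | u x = 0]) = 0%E \/ mu [set x | d <= u x] = 0%E.
Proof.
move=> s0 s1 p1 oO cL c0 wsp u0 r0 qO d0.
have p0 : 0 < p by lra.
have [[[muu _] uW _] _ _] := wsp.
have mO := open_measurable_rV oO.
(* [S] contains the support of the cutoff, and its closure lies in [Omega], where
   [c] is integrable on compact sets. *)
set S : set V := ball q (2 * r).
have mS : measurable S by exact: measurable_ball_rV.
have oS : open S by exact: ball_open.
have clS : closure S `<=` Omega.
  move=> x Sx; apply: qO.
  have [y [Sy xy]] := Sx _ (nbhsx_ballx x r r0).
  move: Sy xy; rewrite /S -!ball_normE/= => qy xy.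
  rewrite (le_lt_trans (ler_distD y _ _))// (distrC y).
  by have := ltrD qy xy; rewrite (_ : 2 * r + r = 3 * r)//; ring.
have SO : S `<=` Omega by move=> x /subset_closure; exact: clS.
have bS : bounded_set S.
  exists (`|q| + 2 * r); split; first exact: num_real.
  move=> M qM x; rewrite /S -ball_normE/= => qx; apply: le_trans (ltW qM).
  have -> : x = q - (q - x) by rewrite subKr.
  by rewrite (le_trans (ler_normB _ _))// lerD2l ltW.
have [U [_ [cS _] _]] := uW S bS SO.
have Soo : (mu S < +oo)%E by exact: lebesgue_rV_bounded.
set eta := cutoff q r.
have meta : measurable_fun setT eta by exact: measurable_cutoff.
have eta01 := cutoff_itv q r; have etaS := cutoff_out (q := q) r0.
have getaoo : (gagliardo s p setT eta < +oo)%E.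
  exact: (gagliardo_lipschitz_lty s0 s1 p0 r0 mS Soo meta eta01 etaS
           (cutoff_lipschitz q r0)).
have geta : gagliardo s p setT eta \is a fin_num.
  rewrite ge0_fin_numE// gagliardo_setT integral_ge0// => z _.
  by rewrite lee_fin divr_ge0 ?powR_ge0.
have cSoo : (\int[mu]_(x in S) (`|c x|)%:E < +oo)%E.
  have [mc /(_ _ cS clS)] := cL; rewrite /Lp_energy.
  under eq_integral do rewrite powRr1//.
  apply: le_lt_trans; apply: ge0_subset_integral => //.
  - by apply: closed_measurable_rV; exact: closed_closure.
  - apply/measurable_EFinP; apply: measurableT_comp => //.
    exact: (measurable_funS mO clS mc).
  - exact: subset_closure.
have cSfin : (\int[mu]_(x in S) (`|c x|)%:E)%E \is a fin_num.
  by rewrite ge0_fin_numE// integral_ge0.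
set Z := ball q r `&` [set x | u x = 0]; set Y := [set x | d <= u x].
have mZ : measurable Z.
  apply: measurableI; first exact: measurable_ball_rV.
  have -> : [set x | u x = 0] = u @^-1` [set 0] by [].
  by rewrite -[X in measurable X]setTI; exact: muu.
have mY : measurable Y.
  rewrite -[Y]setTI.
  exact: (measurable_fun_le measurableT (measurable_cst d) muu).
apply: (@kernel_separates R N s p) => //.
  by move=> x [_ /= ux]; rewrite /Y/= ux leNgt d0.
apply: (@eq0_of_power_gap p (d `^ (p - 1)) d
  (fine (gagliardo s p setT eta) + fine (\int[mu]_(x in S) (`|c x|)%:E)%E)) => //.
- by rewrite powR_gt0.
- by rewrite integral_ge0// => z _; rewrite lee_fin invr_ge0 powR_ge0.
move=> e e0 ed; pose w x := e * eta x.
have mw : measurable_fun setT w by exact: measurable_funM.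
have w0 x : 0 <= w x by have /andP[h _] := eta01 x; rewrite mulr_ge0// ltW.
have we x : w x <= e.
  by have /andP[_ h] := eta01 x; rewrite -[leRHS]mulr1 ler_wpM2l// ltW.
have wS x : ~ S x -> w x = 0 by move=> /etaS h; rewrite /w /eta h mulr0.
have wpS x : w x `^ p <= \1_S x * e `^ p.
  have [Sx|Sx] := pselect (S x).
    by rewrite indicE mem_set// mul1r le_powR2// ltW.
  by rewrite wS// powR0 ?gt_eqF// mulr_ge0 ?powR_ge0.
have wp : (Lp_energy p setT w < +oo)%E.
  apply: (@le_lt_trans _ _ (\int[mu]_x ((e `^ p)%:E * (\1_S x)%:E))%E).
    apply: ge0_le_integral => //.
    - by apply/measurable_EFinP; exact: measurable_norm_powR.
    - apply: emeasurable_funM => //; apply/measurable_EFinP.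
      exact: measurable_indic.
    - by move=> x _; rewrite -EFinM lee_fin ger0_norm// mulrC wpS.
  have mi : measurable_fun setT (fun x : V => (\1_S x)%:E : \bar R).
    exact/measurable_EFinP/measurable_indic.
  rewrite ge0_integralZl ?lee_fin ?powR_ge0//.
  by rewrite integral_indic// setIT lte_mul_pinfty// lee_fin powR_ge0.
have gw : gagliardo s p setT w = ((e `^ p)%:E * gagliardo s p setT eta)%E.
  by rewrite gagliardoZ// ltW.
have wg : (gagliardo s p setT w < +oo)%E.
  by rewrite gw -(fineK geta) -EFinM ltry.
have wu : {ae mu, forall x, ~ S x -> w x <= u x}.
  by apply: filterS u0 => x ux Sx; rewrite wS.
have cA : (\int[mu]_(x in Omega) (`|c x| * w x `^ p)%:E <=
    (e `^ p * fine (\int[mu]_(x in S) (`|c x|)%:E)%E)%:E)%E.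
  have [mc _] := cL.
  have mcS : measurable_fun S (fun x => `|c x|%:E).
    apply/measurable_EFinP; apply: measurableT_comp => //.
    exact: (measurable_funS mO SO mc).
  rewrite EFinM fineK// -ge0_integralZl ?lee_fin ?powR_ge0//.
  rewrite [leRHS]integral_mkcond [leLHS]integral_mkcond.
  apply: ge0_le_integral => //.
  - by move=> x _; rewrite patchE; case: ifPn => // _; rewrite lee_fin mulr_ge0 ?powR_ge0.
  - apply/(measurable_restrictT _ _).1 => //.
    apply/measurable_EFinP; apply: measurable_funM; first exact: measurableT_comp.
    by apply: (measurableT_comp (measurable_powR p)); exact: measurable_funTS.
  - apply/(measurable_restrictT _ _).1 => //; apply: emeasurable_funM => //.
  - move=> x _; rewrite !patchE; case: ifPn => [Ox|Ox]; case: ifPn => [Sx|Sx] //.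
    + rewrite -EFinM lee_fin mulrC ler_wpM2r// (le_trans (wpS x))//.
      by rewrite indicE Sx mul1r.
    + move: Sx; rewrite notin_setE => Sx.
      by rewrite wS// powR0 ?mulr0 ?gt_eqF.
    + by rewrite -EFinM lee_fin mulr_ge0 ?powR_ge0.
have d0' : 0 <= d `^ (p - 1) * e by rewrite mulr_ge0 ?powR_ge0// ltW.
have := supersolution_energy s0 s1 p1 oO cL c0 wsp oS bS SO mw w0 wp wg wu cA
  (measurableX mZ mY) d0'.
rewrite gw -(fineK geta) -EFinM -EFinD -mulrDr fineK//; apply.
apply: aeW => -[x y] /= [[qx ux] uy].
have Sx : S x by apply: le_ball qx; rewrite ler_peMl ?ler1n// ltW.
have -> : truncation S w u y = 0.
  have [Sy|Sy] := pselect (S y); last exact: truncation_out.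
  rewrite truncation_in// max_l// subr_le0 (le_trans (we y))//.
  exact: le_trans uy.
rewrite truncation_in// ux /w /eta cutoff_in// mulr1 sub0r !subr0.
rewrite (max_r (ltW e0)) -mulNr; apply: ler_wpM2r; first exact: ltW.
rewrite -(spow_ge0E p1 (ltW d0)) -spowN.
by apply: le_spow; rewrite ?lerN2.
Qed.

(** The alternative that holds on each ball does not involve the ball on its
second side, so one ball of the countable cover decides for the whole
space. *)
Lemma supersolution_dichotomy s p Omega c u :
  0 < s -> s < 1 -> 1 < p -> open Omega ->
  in_L1_loc Omega c -> {ae mu, forall x, Omega x -> c x <= 0} ->
  weak_super_potential s p Omega c u ->
  {ae mu, forall x, 0 <= u x} ->
  {ae mu, forall x, Omega x -> 0 < u x} \/ {ae mu, forall x, u x = 0}.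
Proof.
move=> s0 s1 p1 oO cL c0 wsp u0.
have [[[muu _] _ _] _ _] := wsp.
pose B (i : 'rV[rat]_N * nat) : set V :=
  ball (map_mx (ratr : rat -> R) i.1) i.2.+1%:R^-1.
pose cov := [set i : 'rV[rat]_N * nat |
  ball (map_mx (ratr : rat -> R) i.1 : V) (3 * i.2.+1%:R^-1) `<=` Omega].
have [[i Ii Zi]|allZ] := pselect (exists2 i, cov i &
    mu (B i `&` [set x | u x = 0]) <> 0%E).
  right; have Y0 d : 0 < d -> mu [set x | d <= u x] = 0%E.
    move=> d0; have i0 : 0 < i.2.+1%:R^-1 :> R by rewrite invr_gt0.
    have [|//] := supersolution_local_dichotomy s0 s1 p1 oO cL c0 wsp u0 i0 Ii d0.
    by [].
  have : {ae mu, forall x, [set: V] x -> u x <= 0}.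
    apply: ae_le0_of_superlevel => n.
      rewrite -(Y0 n.+1%:R^-1) ?invr_gt0//; congr (mu _).
      by apply/seteqP; split => x //= [].
    exact: measurable_superlevel.
  apply: filterS2 u0 => x ux0 /(_ I) ux1.
  by apply/eqP; rewrite eq_le ux0 ux1.
left.
(* Codes of the indices reduce the countable intersection to one over [nat]. *)
have : {ae mu, forall x, forall n : nat, forall i, unpickle n = Some i -> cov i ->
    ~ (B i x /\ u x = 0)}.
  apply/ae_foralln => n; case: (unpickle n) => [i|]; last by apply: aeW => x i.
  have [Ii|Ii] := pselect (cov i); last by apply: aeW => x _ [<-].
  exists (B i `&` [set x | u x = 0]); split.
  - apply: measurableI; first exact: measurable_ball_rV.
    have -> : [set x | u x = 0] = u @^-1` [set 0] by [].
    by rewrite -[X in measurable X]setTI; exact: muu.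
  - by apply: contrapT => Zi; apply: allZ; exists i.
  - move=> x /= /existsNP[j /not_implyP[[<-] /not_implyP[_ /contrapT]]].
    by [].
apply: filterS2 u0 => x ux h Ox; rewrite lt_neqAle ux andbT eq_sym; apply/eqP => u0.
have : Omega x by []; rewrite (open_rV_ball_cover oO) => -[i Ii ix].
by apply: (h (pickle i) i) => //; rewrite pickleK.
Qed.

End minimum_principle.

(** Boundedness of [Omega] and the sign of [u] off [Omega] serve only to obtain
[u >= 0] almost everywhere, after which the two cases coincide. *)
Theorem theorem1p2 (R : realType) (N : nat) (s p : R)
    (Omega : set 'rV[R]_N) (c u : 'rV[R]_N -> R) :
  (0 < N)%N -> open Omega -> 0 < s -> s < 1 -> 1 < p ->
  in_L1_loc Omega c ->
  {ae lebesgue_rV R N, forall x, Omega x -> c x <= 0} ->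
  in_calW s p Omega u ->
  weak_super_potential s p Omega c u ->
  (bounded_set Omega ->
   {ae lebesgue_rV R N, forall x, (~` Omega) x -> 0 <= u x} ->
   {ae lebesgue_rV R N, forall x, Omega x -> 0 < u x} \/
   {ae lebesgue_rV R N, forall x, u x = 0}) /\
  ({ae lebesgue_rV R N, forall x, 0 <= u x} ->
   {ae lebesgue_rV R N, forall x, Omega x -> 0 < u x} \/
   {ae lebesgue_rV R N, forall x, u x = 0}).
Proof.
move=> N0 oO s0 s1 p1 cL c0 _ wsp; split=> [bO u0|u0].
  apply: (supersolution_dichotomy s0 s1 p1 oO cL c0 wsp).
  exact: (supersolution_ge0 N0 s0 s1 p1 oO bO cL c0 wsp u0).
exact: (supersolution_dichotomy s0 s1 p1 oO cL c0 wsp u0).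
Qed.
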